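(* Let $\Bbbk$ be a field, let $G$ be a nontrivial finite group with $\operatorname{char}\Bbbk\nmid |G|$, and let $R$ be a noetherian left $G$-module algebra over $\Bbbk$. Let $\mathfrak r=\mathfrak r(R,G)$ be the $G$-radical of $R$, $A=R^G$, $\mathfrak a=A\cap\mathfrak r$, $B=R*G$ the skew group algebra and $\mathfrak b=\mathfrak r\otimes\Bbbk G\subseteq B$. Assume that $\mathfrak a$ and $\mathfrak r$ are cofinal and that $\mathfrak a$ has the right Artin–Rees property. (i) The functor $\operatorname{Hom}_A(R,-):\operatorname{Mod}A\to\operatorname{Mod}B$ induces a functor $$\operatorname{Hom}_{\mathcal A}(\mathcal R,-):\operatorname{QMod}_{\mathfrak a}A\to\operatorname{QMod}_{\mathfrak b}B.$$ (ii) The functors $-\otimes_{\mathcal B}\mathcal R:\operatorname{QMod}_{\mathfrak b}B\to\operatorname{QMod}_{\mathfrak a}A$ and $\operatorname{Hom}_{\mathcal A}(\mathcal R,-)$ are quasi-inverse to each other.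
   Context: All algebras are $\Bbbk$-algebras; noetherian means left and right noetherian. A left $G$-module algebra $R$ is an algebra on which $G$ acts by $\Bbbk$-algebra automorphisms; $R^G$ is the subalgebra of invariants. The skew group algebra $R*G$ is $R\otimes\Bbbk G$ with $(r\otimes g)(s\otimes h)=r(g\cdot s)\otimes gh$. Pertinent sequences and $G$-radical: sequences $(a_1,\dots,a_n)$, $(b_1,\dots,b_n)$ in $R$ are pertinent under the $G$-action if $\sum_{i}a_i(g\cdot b_i)=0$ for all $1\ne g\in G$. The $G$-radical is the two-sided ideal $\mathfrak r(R,G)=\{\sum_{i=1}^n a_ib_i : n\ge 1,\ (a_1,\dots,a_n),(b_1,\dots,b_n)\text{ pertinent under the }G\text{-action}\}$ of $R$; it is $G$-stable, so $\mathfrak b$ is an ideal of $B$. Right Artin–Rees (AR) property of an ideal $\mathfrak a$ of $A$: for every right ideal $\mathfrak c$ of $A$ there is $n$ with $\mathfrak c\cap\mathfrak a^n\subseteq\mathfrak c\mathfrak a$ (equivalently, for every finitely generated right $A$-module $M$ and submodule $N\subseteq M$, $N\cap M\mathfrak a^n\subseteq N\mathfrak a$ for some $n$). Cofinal: $\mathfrak a$ and $\mathfrak r$ are cofinal if (i) $\mathfrak aR=R\mathfrak a$, and (ii) for each $s$ there is an integer $n$ with $\mathfrak r^n\subseteq\mathfrak a^sR$. Quotient categories: for an ideal $\mathfrak s$ of a noetherian algebra $S$, $\operatorname{Mod}S$ is the category of right $S$-modules, $\Gamma_{\mathfrak s}=\varinjlim_n\operatorname{Hom}_S(S/\mathfrak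 s^n,-)$, a right module $M$ is $\mathfrak s$-torsion if $\Gamma_{\mathfrak s}(M)=M$, $\operatorname{Tor}_{\mathfrak s}S$ is the (localizing) full subcategory of $\mathfrak s$-torsion modules, and $\operatorname{QMod}_{\mathfrak s}S=\operatorname{Mod}S/\operatorname{Tor}_{\mathfrak s}S$ is the Serre quotient, with projection functor $\pi$. We write $\mathcal M=\pi(M)$. Functors: $R$ is a $B$-$A$-bimodule via $(r\otimes g)\cdot x=r(g\cdot x)$ and right multiplication by $A$. The exact functor $-\otimes_BR:\operatorname{Mod}B\to\operatorname{Mod}A$ sends $\mathfrak b$-torsion modules to $\mathfrak a$-torsion modules and so induces an exact functor $-\otimes_{\mathcal B}\mathcal R:\operatorname{QMod}_{\mathfrak b}B\to\operatorname{QMod}_{\mathfrak a}A$. For a right $A$-module $N$, $\operatorname{Hom}_A(R,N)$ is a right $B$-module via $(fb)(x)=f(bx)$. A functor between module categories ''induces'' a functor between the quotient categories if the latter composed with the projection agrees with the projection composed with the former. *)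

(* Defs.v *)
Set Warnings "-notation-overridden,-ambiguous-paths".
Set Warnings "-redundant-canonical-projection,-projection-no-head-constant".
From HB Require Import structures.
From mathcomp Require Import all_boot all_order all_algebra all_fingroup.
From mathcomp Require Import boolp classical_sets.

Set Implicit Arguments.
Unset Strict Implicit.
Unset Printing Implicit Defensive.

Import GRing.Theory.
Local Open Scope ring_scope.

Record quot (T : Type) (e : T -> T -> Prop) := Quot {
  qset : T -> Prop;
  qsetP : exists t, qset = e t }.

Section Quot.
Variables (T : Type) (e : T -> T -> Prop).
Hypothesis erefl_e : forall x, e x x.
Hypothesis esym_e : forall x y, e x y -> e y x.
Hypothesis etrans_e : forall x y z, e x y -> e y z -> e x z.

Definition qcls (t : T) : quot e := Quot (ex_intro _ t erefl).
Definition qrep (c : quot e) : T := sval (cid (qsetP c)).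

Lemma quot_inj (c d : quot e) : qset c = qset d -> c = d.
Proof.
by case: c d => [c cP] [d dP] /= cd; subst d; congr Quot; apply: Prop_irrelevance.
Qed.

Lemma qrepK c : qcls (qrep c) = c.
Proof. by apply: quot_inj; rewrite /qrep; case: cid. Qed.

Lemma qcls_eq x y : e x y -> qcls x = qcls y.
Proof.
move=> xy; apply: quot_inj; apply/funext => z; apply/propext.
by split; apply: etrans_e => //; apply: esym_e.
Qed.

Lemma qcls_inj x y : qcls x = qcls y -> e x y.
Proof. by move=> /(congr1 (@qset _ _)) /= ->; apply: erefl_e. Qed.

Lemma qrep_cls x : e x (qrep (qcls x)).
Proof. by apply: qcls_inj; rewrite qrepK. Qed.

End Quot.

Record category := Category {
  obj :> Type;
  mor : obj -> obj -> Type;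
  idm : forall a, mor a a;
  mcomp : forall a b c, mor b c -> mor a b -> mor a c;
  comp1m : forall a b (f : mor a b), mcomp (idm b) f = f;
  compm1 : forall a b (f : mor a b), mcomp f (idm a) = f;
  compmA : forall a b c d (h : mor c d) (g : mor b c) (f : mor a b),
    mcomp h (mcomp g f) = mcomp (mcomp h g) f }.

Arguments mor {C} a b : rename.
Arguments idm {C} a : rename.
Arguments mcomp {C a b c} g f : rename.

Definition is_iso (C : category) (a b : C) (f : mor a b) : Prop :=
  exists g : mor b a, mcomp g f = idm a /\ mcomp f g = idm b.

Record functor (C D : category) := Functor {
  fobj :> C -> D;
  fmap : forall a b : C, mor a b -> mor (fobj a) (fobj b);
  fmap1 : forall a, fmap (idm a) = idm (fobj a);
  fmapM : forall a b c (g : mor b c) (f : mor a b),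
    fmap (mcomp g f) = mcomp (fmap g) (fmap f) }.

Section FunctorOps.
Variables C D E : category.

Definition fid : functor C C :=
  @Functor C C id (fun _ _ => id) (fun=> erefl) (fun _ _ _ _ _ => erefl).

Variables (G : functor D E) (F : functor C D).

Fact fcomp1 a : fmap G (fmap F (idm a)) = idm (G (F a)).
Proof. by rewrite !fmap1. Qed.

Fact fcompM a b c (g : mor b c) (f : mor a b) :
  fmap G (fmap F (mcomp g f)) =
  mcomp (fmap G (fmap F g)) (fmap G (fmap F f)).
Proof. by rewrite !fmapM. Qed.

Definition fcomp : functor C E :=
  @Functor C E (fun a => G (F a)) (fun _ _ f => fmap G (fmap F f))
    fcomp1 fcompM.
End FunctorOps.

Arguments fid C : clear implicits.

Definition nat_isomorphic (C D : category) (F G : functor C D) : Prop :=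
  exists eta : forall a, mor (F a) (G a),
    (forall a, is_iso (eta a)) /\
    (forall a b (f : mor a b),
       mcomp (eta b) (fmap F f) = mcomp (fmap G f) (eta a)).

Definition quasi_inverse (C D : category) (F : functor C D) (G : functor D C) :
    Prop :=
  nat_isomorphic (fcomp G F) (fid C) /\ nat_isomorphic (fcomp F G) (fid D).

(* Category of fractions C[W^-1] (Gabriel-Zisman): same objects as C;       *)
(* morphisms are paths made of morphisms of C and of formal inverses of     *)
(* morphisms of W, modulo the congruence zeq. A zigzag c a goes from a to c.*)

Section Fractions.
Variables (C : category) (W : forall a b : C, mor a b -> Prop).

Inductive zigzag (c : C) : C -> Type :=
| znil : zigzag c c
| zfwd a b (f : mor a b) (z : zigzag c b) : zigzag c a
| zbwd a b (w : mor b a) (Ww : W w) (z : zigzag c b) : zigzag c a.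

Arguments znil {c}.

Inductive zeq (c : C) : forall a, zigzag c a -> zigzag c a -> Prop :=
| zeq_refl a (z : zigzag c a) : zeq z z
| zeq_sym a (z1 z2 : zigzag c a) : zeq z1 z2 -> zeq z2 z1
| zeq_trans a (z1 z2 z3 : zigzag c a) : zeq z1 z2 -> zeq z2 z3 -> zeq z1 z3
| zeq_fwd a b (f : mor a b) (z1 z2 : zigzag c b) :
    zeq z1 z2 -> zeq (zfwd f z1) (zfwd f z2)
| zeq_bwd a b (w : mor b a) (Ww : W w) (z1 z2 : zigzag c b) :
    zeq z1 z2 -> zeq (zbwd Ww z1) (zbwd Ww z2)
| zeq_id a (z : zigzag c a) : zeq (zfwd (idm a) z) z
| zeq_comp a b d (f : mor a b) (g : mor b d) (z : zigzag c d) :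
    zeq (zfwd (mcomp g f) z) (zfwd f (zfwd g z))
| zeq_fwdK a b (w : mor a b) (Ww : W w) (z : zigzag c a) :
    zeq (zfwd w (zbwd Ww z)) z
| zeq_bwdK a b (w : mor a b) (Ww : W w) (z : zigzag c b) :
    zeq (zbwd Ww (zfwd w z)) z.

Fixpoint zcat (c d a : C) (z : zigzag c a) (z' : zigzag d c) : zigzag d a :=
  match z in zigzag _ x return zigzag d x with
  | znil => z'
  | zfwd _ _ f z1 => zfwd f (zcat z1 z')
  | zbwd _ _ _ Ww z1 => zbwd Ww (zcat z1 z')
  end.

Lemma zcat_nil c a (z : zigzag c a) : zcat z znil = z.
Proof. by elim: z => //= [x y f|x y f Wf] z ->. Qed.

Lemma zcatA c d e a (z1 : zigzag c a) (z2 : zigzag d c) (z3 : zigzag e d) :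
  zcat (zcat z1 z2) z3 = zcat z1 (zcat z2 z3).
Proof. by elim: z1 z2 => //= [x y f|x y f Wf] z IH z2; rewrite IH. Qed.

Lemma zeq_catr c d a (z : zigzag c a) (z1 z2 : zigzag d c) :
  zeq z1 z2 -> zeq (zcat z z1) (zcat z z2).
Proof.
by elim: z z1 z2 => //= [x y f|x y f Wf] z IH z1 z2 /IH; constructor.
Qed.

Lemma zeq_catl c d a (z1 z2 : zigzag c a) (z : zigzag d c) :
  zeq z1 z2 -> zeq (zcat z1 z) (zcat z2 z).
Proof.
elim=> /=; try by (move=> *; constructor).
by move=> b y1 y2 y3 _ h1 _ h2; apply: zeq_trans h2.
Qed.

Definition frac_hom (a b : C) : Type := quot (@zeq b a).

Definition frac_cls a b (z : zigzag b a) : frac_hom a b := qcls (@zeq b a) z.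

Lemma frac_clsE a b (z1 z2 : zigzag b a) :
  zeq z1 z2 -> frac_cls z1 = frac_cls z2.
Proof.
by apply: qcls_eq; [apply: zeq_sym | apply: zeq_trans].
Qed.

Lemma frac_rep a b (z : zigzag b a) : zeq (qrep (frac_cls z)) z.
Proof. by apply: zeq_sym; apply: qrep_cls; apply: zeq_refl. Qed.

Definition frac_id (a : C) : frac_hom a a := frac_cls znil.

Definition frac_comp a b c (g : frac_hom b c) (f : frac_hom a b) :
  frac_hom a c := frac_cls (zcat (qrep f) (qrep g)).

Lemma frac_comp_cls a b c (y : zigzag c b) (z : zigzag b a) :
  frac_comp (frac_cls y) (frac_cls z) = frac_cls (zcat z y).
Proof.
apply: frac_clsE; apply: (zeq_trans (z2 := zcat z (qrep (frac_cls y)))).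
  by apply: zeq_catl; apply: frac_rep.
by apply: zeq_catr; apply: frac_rep.
Qed.

Lemma frac_comp1m a b (f : frac_hom a b) : frac_comp (frac_id b) f = f.
Proof. by rewrite -(qrepK f) [LHS]frac_comp_cls zcat_nil. Qed.

Lemma frac_compm1 a b (f : frac_hom a b) : frac_comp f (frac_id a) = f.
Proof. by rewrite -(qrepK f) [LHS]frac_comp_cls. Qed.

Lemma frac_compmA a b c d (h : frac_hom c d) (g : frac_hom b c)
    (f : frac_hom a b) :
  frac_comp h (frac_comp g f) = frac_comp (frac_comp h g) f.
Proof.
rewrite -(qrepK f) -(qrepK g) -(qrepK h) -!/(frac_cls _).
by rewrite !frac_comp_cls zcatA.
Qed.

Definition fractions : category :=
  @Category C frac_hom frac_id frac_comp frac_comp1m frac_compm1 frac_compmA.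

Definition frac_map a b (f : mor a b) : frac_hom a b := frac_cls (zfwd f znil).

Fact frac_map1 a : frac_map (idm a) = frac_id a.
Proof. by apply: frac_clsE; apply: zeq_id. Qed.

Fact frac_mapM a b c (g : mor b c) (f : mor a b) :
  frac_map (mcomp g f) = frac_comp (frac_map g) (frac_map f).
Proof. by rewrite frac_comp_cls; apply: frac_clsE; apply: zeq_comp. Qed.

Definition frac_proj : functor C fractions :=
  @Functor C fractions id frac_map frac_map1 frac_mapM.

Lemma frac_proj_iso a b (w : mor a b) : W w -> is_iso (fmap frac_proj w).
Proof.
move=> Ww; exists (frac_cls (zbwd Ww znil)).
split; rewrite /= frac_comp_cls /=; apply: frac_clsE.
  exact: zeq_fwdK.
exact: zeq_bwdK.
Qed.

End Fractions.

Lemma functor_eq (C' D' : category) (o : C' -> D')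
    (m1 m2 : forall a b, mor a b -> mor (o a) (o b)) i1 i2 c1 c2 :
  (forall a b (f : mor a b), m1 a b f = m2 a b f) ->
  @Functor C' D' o m1 i1 c1 = @Functor C' D' o m2 i2 c2.
Proof.
move=> m12; have {}m12 : m1 = m2.
  apply: functional_extensionality_dep => a.
  apply: functional_extensionality_dep => b.
  exact/funext/m12.
subst m2; congr Functor; apply: Prop_irrelevance.
Qed.

Lemma functor_eqD (C D : category) (F G : functor C D) : F = G ->
  exists e : fobj F = fobj G, forall a b (f : mor a b),
    eq_rect (fobj F) (fun o => mor (o a) (o b)) (fmap F f) (fobj G) e = fmap G f.
Proof. by move->; exists erefl. Qed.

Section FractionsUniversal.
Variables (C : category) (W : forall a b : C, mor a b -> Prop) (D : category).

Section Lift.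
Variable F : functor C D.
Hypothesis FW : forall (a b : C) (w : mor a b), W w -> is_iso (fmap F w).

Fixpoint zmap c a (z : zigzag W c a) : mor (F a) (F c) :=
  match z in zigzag _ _ x return mor (F x) (F c) with
  | znil => idm (F c)
  | zfwd _ _ f z1 => mcomp (zmap z1) (fmap F f)
  | zbwd _ _ _ Ww z1 => mcomp (zmap z1) (sval (cid (FW Ww)))
  end.

Lemma zmap_eq c a (z1 z2 : zigzag W c a) : zeq z1 z2 -> zmap z1 = zmap z2.
Proof.
elim=> //=.
- by move=> b x1 x2 x3 _ -> _.
- by move=> x b f y1 y2 _ ->.
- by move=> x b w Ww y1 y2 _ ->.
- by move=> x z; rewrite fmap1 compm1.
- by move=> x b d f g z; rewrite fmapM compmA.
- move=> x b w Ww z; case: cid => g [gw wg] /=.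
  by rewrite -compmA gw compm1.
- move=> x b w Ww z; case: cid => g [gw wg] /=.
  by rewrite -compmA wg compm1.
Qed.

Lemma zmap_cat c d a (z : zigzag W c a) (z' : zigzag W d c) :
  zmap (zcat z z') = mcomp (zmap z') (zmap z).
Proof.
elim: z z' => /= [|x y f z IH|x y w Ww z IH] z'; first by rewrite compm1.
  by rewrite IH compmA.
by rewrite IH compmA.
Qed.

Definition frac_lift_map a b (f : frac_hom W a b) : mor (F a) (F b) :=
  zmap (qrep f).

Lemma frac_lift_cls a b (z : zigzag W b a) :
  frac_lift_map (frac_cls z) = zmap z.
Proof. exact/zmap_eq/frac_rep. Qed.

Fact frac_lift1 a : frac_lift_map (frac_id W a) = idm (F a).
Proof. exact: frac_lift_cls. Qed.

Fact frac_liftM a b c (g : frac_hom W b c) (f : frac_hom W a b) :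
  frac_lift_map (frac_comp g f) = mcomp (frac_lift_map g) (frac_lift_map f).
Proof. by rewrite frac_lift_cls zmap_cat. Qed.

Definition frac_lift : functor (fractions W) D :=
  @Functor (fractions W) D F frac_lift_map frac_lift1 frac_liftM.

End Lift.

Lemma frac_liftE (F : functor C D)
    (FW : forall (a b : C) (w : mor a b), W w -> is_iso (fmap F w)) :
  fcomp (frac_lift FW) (frac_proj W) = F.
Proof.
case: F FW => o m i1 c1 FW; apply: functor_eq => a b f.
by rewrite [LHS]frac_lift_cls /= comp1m.
Qed.

Lemma frac_lift_uniq (H1 H2 : functor (fractions W) D) :
  fcomp H1 (frac_proj W) = fcomp H2 (frac_proj W) -> H1 = H2.
Proof.
case: H1 H2 => [o1 m1 i1 c1] [o2 m2 i2 c2] H12.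
have [e mE] : exists e : o1 = o2, forall (a b : C) (f : mor a b),
    eq_rect o1 (fun o => mor (o a) (o b)) (m1 a b (frac_map W f)) o2 e =
    m2 a b (frac_map W f) := functor_eqD H12.
clear H12; subst o2 => /=; apply: functor_eq => a b f.
have {}mE (x y : C) (g : mor x y) : m1 x y (frac_map W g) = m2 x y (frac_map W g).
  exact: mE.
rewrite -(qrepK f); move: (qrep f) => {f} z.
elim: z => [|x y g z IH|x y w Ww z IH].
- exact: (etrans (i1 b) (esym (i2 b))).
- have -> : qcls _ (zfwd g z) = frac_comp (frac_cls z) (frac_map W g).
    by rewrite frac_comp_cls.
  by rewrite (c1 _ _ _ (frac_cls z)) (c2 _ _ _ (frac_cls z)) mE IH.
have -> : qcls _ (zbwd Ww z) =
    frac_comp (frac_cls z) (frac_cls (zbwd Ww (znil _ _))).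
  by rewrite frac_comp_cls.
rewrite (c1 _ _ _ (frac_cls z)) (c2 _ _ _ (frac_cls z)) IH; congr mcomp.
set v := frac_cls _.
have vw : frac_comp v (frac_map W w) = frac_id W y.
  by rewrite frac_comp_cls; apply/frac_clsE/zeq_fwdK.
have wv : frac_comp (frac_map W w) v = frac_id W x.
  by rewrite frac_comp_cls; apply/frac_clsE/zeq_bwdK.
have m1vw : mcomp (m1 x y v) (m1 y x (frac_map W w)) = idm (o1 y).
  exact: (etrans (esym (c1 _ _ _ _ _)) (etrans (congr1 (m1 y y) vw) (i1 y))).
have m2wv : mcomp (m2 y x (frac_map W w)) (m2 x y v) = idm (o1 x).
  exact: (etrans (esym (c2 _ _ _ _ _)) (etrans (congr1 (m2 x x) wv) (i2 x))).
by rewrite -[LHS]compm1 -m2wv compmA -mE m1vw comp1m.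
Qed.

Theorem frac_universal (F : functor C D) :
  (forall (a b : C) (w : mor a b), W w -> is_iso (fmap F w)) ->
  exists! H : functor (fractions W) D, fcomp H (frac_proj W) = F.
Proof.
move=> FW; exists (frac_lift FW); split; first exact: frac_liftE.
by move=> H HE; apply: frac_lift_uniq; rewrite frac_liftE HE.
Qed.

End FractionsUniversal.

(* Right modules over a ring S: a right S-module is a left module over the  *)
(* converse ring S^c, so that ract m x is m acted on by x on the right.     *)

Definition ract (S : pzRingType) (M : lmodType S^c) (m : M) (x : S) : M :=
  (x : S^c) *: m.

Section ModCategory.
Variable S : pzRingType.

Lemma linear_eq (M N : lmodType S^c) (f g : {linear M -> N}) : f =1 g -> f = g.
Proof.
case: f => f [[f1] [f2]]; case: g => g [[g1] [g2]] /= fg.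
have {}fg : f = g by apply/funext.
subst g; congr GRing.Linear.Pack; congr GRing.Linear.Class.
  by congr Algebra.isNmodMorphism.Axioms_; apply: Prop_irrelevance.
by congr GRing.isScalable.Axioms_; apply: Prop_irrelevance.
Qed.

Definition mod_comp (M N P : lmodType S^c) (g : {linear N -> P})
    (f : {linear M -> N}) : {linear M -> P} := g \o f.

Definition Mod : category.
Proof.
refine (@Category (lmodType S^c) (fun M N => {linear M -> N})
  (fun M => idfun) mod_comp _ _ _).
all: by move=> *; apply: linear_eq.
Defined.

Definition is_kernel (K M N : lmodType S^c) (f : {linear M -> N})
    (i : {linear K -> M}) : Prop :=
  injective i /\ (forall m, f m = 0 <-> exists x, i x = m).

Definition is_cokernel (M N C : lmodType S^c) (f : {linear M -> N})
    (p : {linear N -> C}) : Prop :=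
  (forall c, exists n, p n = c) /\ (forall n, p n = 0 <-> exists m, f m = n).

End ModCategory.

Section Ideals.
Variable S : pzRingType.
Implicit Types I J : set S.

Definition right_ideal I : Prop :=
  [/\ I 0, forall x y, I x -> I y -> I (x + y)
    & forall x c, I x -> I (x * c)].

Definition left_ideal I : Prop :=
  [/\ I 0, forall x y, I x -> I y -> I (x + y)
    & forall c x, I x -> I (c * x)].

Definition noetherian : Prop :=
  (forall I, left_ideal I -> exists n (x : 'I_n -> S), forall z,
     I z <-> exists c : 'I_n -> S, z = \sum_i c i * x i) /\
  (forall I, right_ideal I -> exists n (x : 'I_n -> S), forall z,
     I z <-> exists c : 'I_n -> S, z = \sum_i x i * c i).

Definition mulset I J : set S := fun z =>
  exists n (x y : 'I_n -> S),
    [/\ forall i, I (x i), forall i, J (y i) & z = \sum_i x i * y i].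

Fixpoint ideal_pow I (n : nat) : set S :=
  if n is n'.+1 then mulset (ideal_pow I n') I else setT.

Definition right_AR I : Prop :=
  forall J, right_ideal J -> exists n,
    (J `&` ideal_pow I n `<=` mulset J I)%classic.

End Ideals.

Section QMod.
Variables (S : pzRingType) (s : set S).

(* The value at M of the functor colim_n Hom_S(S/s^n, -), a homomorphism    *)
(* S/s^n -> M being identified with the image m of 1, which is any element  *)
(* of M annihilated by s^n.                                                 *)
Definition Gamma (M : lmodType S^c) : set M := fun m =>
  exists n, forall x, ideal_pow s n x -> ract m x = 0.

Definition torsion (M : lmodType S^c) : Prop := Gamma (M := M) = setT.

Definition serre_equiv (M N : Mod S) (f : mor M N) : Prop :=
  exists (K C : lmodType S^c) (i : {linear K -> M}) (p : {linear N -> C}),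
    [/\ is_kernel f i, is_cokernel f p, torsion K & torsion C].

(* The Serre quotient of Mod S by the torsion modules is the category of    *)
(* fractions of Mod S obtained by inverting the homomorphisms with torsion  *)
(* kernel and torsion cokernel; the torsion modules form a Serre            *)
(* subcategory when S is noetherian and s is an ideal.                      *)
Definition QMod : category := fractions serre_equiv.

Definition qproj : functor (Mod S) QMod := frac_proj serre_equiv.

End QMod.

Definition induces (S T : pzRingType) (s : set S) (t : set T)
    (F : functor (Mod S) (Mod T)) (H : functor (QMod s) (QMod t)) : Prop :=
  fcomp H (qproj s) = fcomp (qproj t) F.

Section Tensor.
Variables (S : pzRingType) (M : lmodType S^c) (P : lmodType S).
Implicit Types (m : M) (p : P) (l : seq (M * P)).

(* A list of pairs stands for the formal sum of its terms.                  *)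
Inductive tens_rel : seq (M * P) -> seq (M * P) -> Prop :=
| tens_refl l : tens_rel l l
| tens_sym l1 l2 : tens_rel l1 l2 -> tens_rel l2 l1
| tens_trans l1 l2 l3 : tens_rel l1 l2 -> tens_rel l2 l3 -> tens_rel l1 l3
| tens_cat l1 l2 l3 l4 :
    tens_rel l1 l2 -> tens_rel l3 l4 -> tens_rel (l1 ++ l3) (l2 ++ l4)
| tens_comm l1 l2 : tens_rel (l1 ++ l2) (l2 ++ l1)
| tens_0l p : tens_rel [:: (0, p)] [::]
| tens_Dl m1 m2 p : tens_rel [:: (m1 + m2, p)] [:: (m1, p); (m2, p)]
| tens_Dr m p1 p2 : tens_rel [:: (m, p1 + p2)] [:: (m, p1); (m, p2)]
| tens_bal m x p : tens_rel [:: (ract m x, p)] [:: (m, x *: p)].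

Definition tensor : Type := quot tens_rel.
Implicit Types t : tensor.

HB.instance Definition _ := gen_eqMixin tensor.
HB.instance Definition _ := gen_choiceMixin tensor.

Definition tens_cls l : tensor := qcls tens_rel l.

Lemma tens_clsE l1 l2 : tens_rel l1 l2 -> tens_cls l1 = tens_cls l2.
Proof. by apply: qcls_eq; [apply: tens_sym | apply: tens_trans]. Qed.

Lemma tens_rep l : tens_rel (qrep (tens_cls l)) l.
Proof. by apply: tens_sym; apply: qrep_cls; apply: tens_refl. Qed.

Lemma tens_ind (Q : tensor -> Prop) : (forall l, Q (tens_cls l)) -> forall t, Q t.
Proof. by move=> Qc t; rewrite -(qrepK t); apply: Qc. Qed.

Definition tens_neg l := [seq (- u.1, u.2) | u <- l].

Lemma tens_neg_rel l1 l2 : tens_rel l1 l2 -> tens_rel (tens_neg l1) (tens_neg l2).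
Proof.
elim=> {l1 l2} /=.
- by move=> l; apply: tens_refl.
- by move=> l1 l2 _; apply: tens_sym.
- by move=> l1 l2 l3 _ h1 _; apply: tens_trans.
- by move=> l1 l2 l3 l4 _ h1 _ h2; rewrite /tens_neg !map_cat; apply: tens_cat.
- by move=> l1 l2; rewrite /tens_neg !map_cat; apply: tens_comm.
- by move=> p; rewrite oppr0; apply: tens_0l.
- by move=> m1 m2 p; rewrite opprD; apply: tens_Dl.
- by move=> m p1 p2; apply: tens_Dr.
- by move=> m x p; rewrite /ract -scalerN; apply: tens_bal.
Qed.

Definition tens_add t1 t2 : tensor := tens_cls (qrep t1 ++ qrep t2).
Definition tens_opp t : tensor := tens_cls (tens_neg (qrep t)).

Lemma tens_add_cls l1 l2 :
  tens_add (tens_cls l1) (tens_cls l2) = tens_cls (l1 ++ l2).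
Proof. by apply: tens_clsE; apply: tens_cat; apply: tens_rep. Qed.

Lemma tens_opp_cls l : tens_opp (tens_cls l) = tens_cls (tens_neg l).
Proof. by apply: tens_clsE; apply: tens_neg_rel; apply: tens_rep. Qed.

Fact tens_addA : associative tens_add.
Proof.
by elim/tens_ind=> x; elim/tens_ind=> y; elim/tens_ind=> z;
   rewrite !tens_add_cls catA.
Qed.

Fact tens_addC : commutative tens_add.
Proof.
elim/tens_ind=> x; elim/tens_ind=> y; rewrite !tens_add_cls.
exact/tens_clsE/tens_comm.
Qed.

Fact tens_add0 : left_id (tens_cls [::]) tens_add.
Proof. by elim/tens_ind=> x; rewrite tens_add_cls. Qed.

Fact tens_addN : left_inverse (tens_cls [::]) tens_opp tens_add.
Proof.
elim/tens_ind=> x; rewrite tens_opp_cls tens_add_cls; apply: tens_clsE.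
elim: x => [|[m p] l IH] /=; first exact: tens_refl.
apply: (tens_trans (l1 := [:: (- m, p)] ++ (tens_neg l ++ ([:: (m, p)] ++ l)))
   (l2 := [:: (- m, p)] ++ ([:: (m, p)] ++ (tens_neg l ++ l)))).
  apply: tens_cat; first exact: tens_refl.
  rewrite !catA; apply: tens_cat; last exact: tens_refl.
  exact: tens_comm.
rewrite catA -[X in tens_rel _ X]cat0s; apply: tens_cat IH.
apply: (tens_trans (l2 := [:: (- m + m, p)])).
  by apply: tens_sym; apply: tens_Dl.
by rewrite addNr; apply: tens_0l.
Qed.

HB.instance Definition _ := GRing.isZmodule.Build tensor
  tens_addA tens_addC tens_add0 tens_addN.

Definition tens m p : tensor := tens_cls [:: (m, p)].

Lemma tens_sum l : tens_cls l = \sum_(u <- l) tens u.1 u.2.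
Proof.
elim: l => [|[m p] l IH]; first by rewrite big_nil.
by rewrite big_cons -IH; apply: esym; apply: tens_add_cls.
Qed.

Lemma tensDl m1 m2 p : tens (m1 + m2) p = tens m1 p + tens m2 p.
Proof.
transitivity (tens_cls [:: (m1, p); (m2, p)]); first exact/tens_clsE/tens_Dl.
by rewrite tens_sum !big_cons big_nil addr0.
Qed.

Lemma tensDr m p1 p2 : tens m (p1 + p2) = tens m p1 + tens m p2.
Proof.
transitivity (tens_cls [:: (m, p1); (m, p2)]); first exact/tens_clsE/tens_Dr.
by rewrite tens_sum !big_cons big_nil addr0.
Qed.

Lemma tensZ m x p : tens (ract m x) p = tens m (x *: p).
Proof. exact/tens_clsE/tens_bal. Qed.

Definition balanced (V : zmodType) (beta : M -> P -> V) : Prop :=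
  [/\ forall m1 m2 p, beta (m1 + m2) p = beta m1 p + beta m2 p,
      forall m p1 p2, beta m (p1 + p2) = beta m p1 + beta m p2
    & forall m x p, beta (ract m x) p = beta m (x *: p)].

Definition tens_lift (V : zmodType) (beta : M -> P -> V) (t : tensor) : V :=
  \sum_(u <- qrep t) beta u.1 u.2.

Section Lift.
Variables (V : zmodType) (beta : M -> P -> V).
Hypothesis bal : balanced beta.

Lemma tens_lift_cls l : tens_lift beta (tens_cls l) = \sum_(u <- l) beta u.1 u.2.
Proof.
case: bal => bDl bDr bZ.
suff lift_rel l1 l2 : tens_rel l1 l2 ->
    \sum_(u <- l1) beta u.1 u.2 = \sum_(u <- l2) beta u.1 u.2.
  exact/lift_rel/tens_rep.
elim=> {l1 l2} //.
- by move=> l1 l2 l3 _ -> _.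
- by move=> l1 l2 l3 l4 _ h1 _ h2; rewrite !big_cat h1 h2.
- by move=> l1 l2; rewrite !big_cat; apply: addrC.
- move=> p; rewrite big_seq1 big_nil /=.
  by apply: (addrI (beta 0 p)); rewrite -bDl !addr0.
- by move=> m1 m2 p; rewrite !big_cons !big_nil !addr0 bDl.
- by move=> m p1 p2; rewrite !big_cons !big_nil !addr0 bDr.
- by move=> m x p; rewrite !big_seq1 bZ.
Qed.

Lemma tens_liftE m p : tens_lift beta (tens m p) = beta m p.
Proof. by rewrite tens_lift_cls big_seq1. Qed.

Lemma tens_liftD t1 t2 :
  tens_lift beta (t1 + t2) = tens_lift beta t1 + tens_lift beta t2.
Proof.
elim/tens_ind: t1 => l1; elim/tens_ind: t2 => l2.
by rewrite [_ + _]tens_add_cls !tens_lift_cls big_cat.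
Qed.
End Lift.

Lemma tens_elim (Q : tensor -> Prop) :
  (forall m p, Q (tens m p)) -> Q 0 ->
  (forall t1 t2, Q t1 -> Q t2 -> Q (t1 + t2)) ->
  forall t, Q t.
Proof.
move=> Qt Q0 QD; elim/tens_ind => l; rewrite tens_sum.
by elim/big_ind: _ => // u _; apply: Qt.
Qed.

Lemma tens_ext (V : zmodType) (f g : tensor -> V) :
  {morph f : x y / x + y} -> {morph g : x y / x + y} ->
  (forall m p, f (tens m p) = g (tens m p)) -> f =1 g.
Proof.
have f0 (h : tensor -> V) : {morph h : x y / x + y} -> h 0 = 0.
  by move=> hD; apply: (addrI (h 0)); rewrite -hD !addr0.
move=> fD gD fg; elim/tens_elim => //; first by rewrite !f0.
by move=> t1 t2 h1 h2; rewrite fD gD h1 h2.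
Qed.

End Tensor.

Record galgebra (k : fieldType) (gT : finGroupType) (R : algType k) :=
  GAlgebra {
    gact :> gT -> {lrmorphism R -> R};
    gact1 : gact 1%g =1 id;
    gactM : forall g h, gact (g * h)%g =1 gact g \o gact h }.

(* The skew group algebra: b : skew X stands for \sum_g b g (x) g. The       *)
(* argument X only serves to attach the product to the type.                *)
Definition skew (k : fieldType) (gT : finGroupType) (R : algType k)
  (X : galgebra gT R) : Type :=
  {ffun gT -> R}.

(* R as a left module over its skew group algebra, and as a right module    *)
(* over its ring of invariants.                                             *)
Definition Rl (k : fieldType) (gT : finGroupType) (R : algType k)
  (X : galgebra gT R) : Type := R.
Definition Rr (k : fieldType) (gT : finGroupType) (R : algType k)
  (X : galgebra gT R) : Type := R.

Section GAlgebra.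
Variables (k : fieldType) (gT : finGroupType) (R : algType k).
Variable X : galgebra gT R.
Local Notation skew := (skew X).
Local Notation Rl := (Rl X).
Local Notation Rr := (Rr X).

Definition ginvariant : {pred R} := [pred r | [forall g, X g r == r]].

Lemma ginvariantP r : reflect (forall g, X g r = r) (r \in ginvariant).
Proof. by apply: (iffP forallP) => h g; apply/eqP. Qed.

Fact invariant_subalg : GRing.subsemialg_closed ginvariant.
Proof.
split; first by apply/ginvariantP => g; rewrite rmorph1.
- split; first by apply/ginvariantP => g; rewrite rmorph0.
  by move=> x y /ginvariantP hx /ginvariantP hy; apply/ginvariantP => g;
     rewrite rmorphD /= hx hy.
- by move=> c x /ginvariantP hx; apply/ginvariantP => g; rewrite linearZ /= hx.
- by move=> x y /ginvariantP hx /ginvariantP hy; apply/ginvariantP => g;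
     rewrite rmorphM /= hx hy.
Qed.

Record invring : Type := InvRing { inv_val : R; _ : inv_val \in ginvariant }.

HB.instance Definition _ := [isSub for inv_val].
HB.instance Definition _ := [Choice of invring by <:].
HB.instance Definition _ :=
  GRing.SubChoice_isSubAlgebra.Build k R ginvariant invring invariant_subalg.

Definition pertinent n (a b : 'I_n -> R) : Prop :=
  forall g : gT, g != 1%g -> \sum_i a i * X g (b i) = 0.

Definition radical : set R := fun f =>
  exists n (a b : 'I_n -> R),
    [/\ (0 < n)%N, pertinent a b & f = \sum_i a i * b i].

Definition inv_radical : set invring := fun x => radical (inv_val x).

Definition extend (a : set invring) : set R :=
  mulset (inv_val @` a)%classic setT.

Definition cofinal (a : set invring) (r : set R) : Prop :=
  extend a = mulset setT (inv_val @` a)%classic /\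
  (forall s, exists n, (ideal_pow r n `<=` extend (ideal_pow a s))%classic).

HB.instance Definition _ := GRing.Lmodule.on skew.

Definition skew_elt (r : R) (g : gT) : skew := [ffun h => r *+ (h == g)].

Definition skew_one : skew := skew_elt 1 1%g.
Definition skew_mul (b c : skew) : skew :=
  [ffun h => \sum_g b g * X g (c (g^-1 * h)%g)].

Lemma skew_eltE r g h : skew_elt r g h = r *+ (h == g).
Proof. by rewrite ffunE. Qed.

Fact skew_mulA : associative skew_mul.
Proof.
move=> a b c; apply/ffunP => h; rewrite !ffunE.
transitivity (\sum_g \sum_u a g * X g (b u) * X (g * u)%g (c ((g * u)^-1 * h)%g)).
  apply: eq_bigr => g _; rewrite ffunE rmorph_sum mulr_sumr.
  apply: eq_bigr => u _; rewrite rmorphM mulrA gactM /= invMg mulgA.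
  by [].
transitivity (\sum_u \sum_g a g * X g (b (g^-1 * u)%g) * X u (c (u^-1 * h)%g)).
  rewrite [RHS]exchange_big /=; apply: eq_bigr => g _.
  rewrite [RHS](reindex_inj (mulgI g)) /=; apply: eq_bigr => u _.
  by rewrite mulKg.
by apply: eq_bigr => u _; rewrite ffunE mulr_suml.
Qed.

Fact skew_mul1 : left_id skew_one skew_mul.
Proof.
move=> b; apply/ffunP => h; rewrite ffunE (bigD1 1%g) //= big1 => [|g g1].
  by rewrite ffunE eqxx mul1r gact1 invg1 mul1g addr0.
by rewrite ffunE (negbTE g1) mul0r.
Qed.

Fact skew_mulr1 : right_id skew_one skew_mul.
Proof.
move=> b; apply/ffunP => h; rewrite ffunE (bigD1 h) //= big1 => [|g gh].
  by rewrite mulVg ffunE eqxx rmorph1 mulr1 addr0.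
rewrite ffunE (_ : (g^-1 * h == 1)%g = false) ?rmorph0 ?mulr0 //.
by apply: contra_neqF gh; rewrite -eq_mulVg1 => /eqP.
Qed.

Fact skew_mulDl : left_distributive skew_mul +%R.
Proof.
move=> a b c; apply/ffunP => h; rewrite !ffunE -big_split /=.
by apply: eq_bigr => g _; rewrite ffunE mulrDl.
Qed.

Fact skew_mulDr : right_distributive skew_mul +%R.
Proof.
move=> a b c; apply/ffunP => h; rewrite !ffunE -big_split /=.
by apply: eq_bigr => g _; rewrite ffunE rmorphD mulrDr.
Qed.

Fact skew_one_neq0 : skew_one != 0.
Proof.
by apply/eqP => /ffunP/(_ 1%g)/eqP; rewrite !ffunE eqxx oner_eq0.
Qed.

HB.instance Definition _ := GRing.Zmodule_isNzRing.Build skew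
  skew_mulA skew_mul1 skew_mulr1 skew_mulDl skew_mulDr skew_one_neq0.

Fact skew_scaleAl (c : k) (a b : skew) : c *: (a * b) = (c *: a) * b.
Proof.
apply/ffunP => h; rewrite !ffunE scaler_sumr.
by apply: eq_bigr => g _; rewrite ffunE scalerAl.
Qed.

HB.instance Definition _ := GRing.Lmodule_isLalgebra.Build k skew skew_scaleAl.

Fact skew_scaleAr (c : k) (a b : skew) : c *: (a * b) = a * (c *: b).
Proof.
apply/ffunP => h; rewrite !ffunE scaler_sumr.
by apply: eq_bigr => g _; rewrite ffunE linearZ scalerAr.
Qed.

HB.instance Definition _ := GRing.Lalgebra_isAlgebra.Build k skew skew_scaleAr.

Lemma skew_eltM r s g h :
  skew_elt r g * skew_elt s h = skew_elt (r * X g s) (g * h)%g.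
Proof.
apply/ffunP => u; rewrite !ffunE (bigD1 g) //= big1 => [|v vg].
  by rewrite !ffunE eqxx addr0 rmorphMn mulrnAr -(inj_eq (mulgI g)) mulKVg.
by rewrite ffunE (negbTE vg) mul0r.
Qed.

Definition skew_radical : set skew := fun b => forall g, radical (b g).

HB.instance Definition _ := GRing.Zmodule.on Rl.

Definition skew_act (b : skew) (r : Rl) : Rl := \sum_g b g * X g r.

Fact skew_actA a b r : skew_act a (skew_act b r) = skew_act (a * b) r.
Proof.
rewrite /skew_act.
transitivity (\sum_g \sum_u a g * X g (b u) * X (g * u)%g r).
  apply: eq_bigr => g _; rewrite rmorph_sum mulr_sumr.
  by apply: eq_bigr => u _; rewrite rmorphM mulrA gactM.
transitivity (\sum_u \sum_g a g * X g (b (g^-1 * u)%g) * X u r).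
  rewrite [RHS]exchange_big /=; apply: eq_bigr => g _.
  rewrite [RHS](reindex_inj (mulgI g)) /=; apply: eq_bigr => u _.
  by rewrite mulKg.
by apply: eq_bigr => u _; rewrite ffunE mulr_suml.
Qed.

Fact skew_act1 : left_id 1 skew_act.
Proof.
move=> r; rewrite /skew_act (bigD1 1%g) //= big1 => [|g g1].
  by rewrite ffunE eqxx mul1r gact1 addr0.
by rewrite ffunE (negbTE g1) mul0r.
Qed.

Fact skew_actDr : right_distributive skew_act +%R.
Proof.
move=> a r s; rewrite /skew_act -big_split /=.
by apply: eq_bigr => g _; rewrite rmorphD mulrDr.
Qed.

Fact skew_actDl r : {morph skew_act^~ r : a b / a + b}.
Proof.
move=> a b; rewrite /skew_act -big_split /=.
by apply: eq_bigr => g _; rewrite ffunE mulrDl.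
Qed.

HB.instance Definition _ := GRing.Zmodule_isLmodule.Build skew Rl
  skew_actA skew_act1 skew_actDr skew_actDl.

HB.instance Definition _ := GRing.Zmodule.on Rr.

Definition inv_act (x : invring^c) (r : Rr) : Rr := (r : R) * inv_val x.

Fact inv_actA x y r : inv_act x (inv_act y r) = inv_act (x * y) r.
Proof. by rewrite /inv_act -mulrA. Qed.
Fact inv_act1 : left_id 1 inv_act.
Proof. by move=> r; rewrite /inv_act mulr1. Qed.
Fact inv_actDr : right_distributive inv_act +%R.
Proof. by move=> x r s; apply: mulrDl. Qed.
Fact inv_actDl r : {morph inv_act^~ r : x y / x + y}.
Proof. by move=> x y; apply: mulrDr. Qed.

HB.instance Definition _ := GRing.Zmodule_isLmodule.Build (invring^c) Rr
  inv_actA inv_act1 inv_actDr inv_actDl.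

Lemma skew_inv_act (b : skew) (x : invring) (r : R) :
  skew_act b (inv_act x r) = inv_act x (skew_act b r).
Proof.
rewrite /skew_act /inv_act mulr_suml; apply: eq_bigr => g _.
by rewrite rmorphM -mulrA; case: x => x /= /ginvariantP ->.
Qed.

Section TensorFunctor.
Variable M : lmodType skew^c.

Definition tensR : Type := tensor M Rl.
HB.instance Definition _ := GRing.Zmodule.on tensR.

Definition tensR_beta (x : invring) (m : M) (r : Rl) : tensR :=
  tens m (inv_act x r : Rl).

Fact tensR_bal x : balanced (tensR_beta x).
Proof.
split=> [m1 m2 p|m p1 p2|m b p].
- exact: tensDl.
- by rewrite /tensR_beta [inv_act x (p1 + p2)]inv_actDr; apply: tensDr.
- by rewrite /tensR_beta tensZ; congr (tens m _); apply: skew_inv_act.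
Qed.

Definition tensR_act (x : invring^c) (t : tensR) : tensR :=
  tens_lift (tensR_beta x) t.

Lemma tensR_actE x m r : tensR_act x (tens m r) = tens m (inv_act x r : Rl).
Proof. exact/tens_liftE/tensR_bal. Qed.

Fact tensR_actDr : right_distributive tensR_act +%R.
Proof. by move=> x t1 t2; apply/tens_liftD/tensR_bal. Qed.

Fact tensR_actA x y t : tensR_act x (tensR_act y t) = tensR_act (x * y) t.
Proof.
apply: (tens_ext (f := tensR_act x \o tensR_act y) (g := tensR_act (x * y))).
- by move=> t1 t2 /=; rewrite !tensR_actDr.
- by move=> t1 t2; rewrite tensR_actDr.
- by move=> m r /=; rewrite !tensR_actE inv_actA.
Qed.

Fact tensR_act1 : left_id 1 tensR_act.
Proof.
apply: (tens_ext (f := tensR_act 1) (g := id)) => //.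
- by move=> t1 t2; rewrite tensR_actDr.
- by move=> m r /=; rewrite !tensR_actE inv_act1.
Qed.

Fact tensR_actDl t : {morph tensR_act^~ t : x y / x + y}.
Proof.
move=> x y; apply: (tens_ext (f := tensR_act (x + y))
  (g := fun t => tensR_act x t + tensR_act y t)).
- by move=> t1 t2; rewrite tensR_actDr.
- by move=> t1 t2; rewrite !tensR_actDr addrACA.
- by move=> m r /=; rewrite !tensR_actE inv_actDl [LHS]tensDr.
Qed.

HB.instance Definition _ := GRing.Zmodule_isLmodule.Build (invring^c) tensR
  tensR_actA tensR_act1 tensR_actDr tensR_actDl.
End TensorFunctor.

Section TensorMap.
Variables (M N : lmodType skew^c) (f : {linear M -> N}).

Definition tensR_map (t : tensR M) : tensR N :=
  tens_lift (fun m r => tens (f m) r : tensR N) t.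

Fact tensR_map_bal : balanced (fun m (r : Rl) => tens (f m) r : tensR N).
Proof.
split=> [m1 m2 p|m p1 p2|m b p].
- by rewrite raddfD [LHS]tensDl.
- exact: tensDr.
- by rewrite /ract linearZ [LHS]tensZ.
Qed.

Lemma tensR_mapE m r : tensR_map (tens m r) = tens (f m) r.
Proof. exact/tens_liftE/tensR_map_bal. Qed.

Lemma tensR_mapD : {morph tensR_map : x y / x + y}.
Proof. by move=> t1 t2; apply/tens_liftD/tensR_map_bal. Qed.

Fact tensR_map_linear : linear tensR_map.
Proof.
move=> x t1 t2; rewrite tensR_mapD; congr (_ + _).
apply: (tens_ext (f := fun t => tensR_map (tensR_act x t))
  (g := fun t => tensR_act x (tensR_map t))).
- by move=> u1 u2; rewrite tensR_actDr tensR_mapD.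
- by move=> u1 u2; rewrite tensR_mapD tensR_actDr.
- by move=> m r; rewrite tensR_actE !tensR_mapE tensR_actE.
Qed.

HB.instance Definition _ :=
  GRing.isLinear.Build invring^c (tensR M) (tensR N) *:%R tensR_map
    tensR_map_linear.
End TensorMap.

Fact tensR_map1 (M : Mod skew) :
  tensR_map (idm M) = idm (tensR M : Mod invring) :> {linear _ -> _}.
Proof.
apply: linear_eq; apply: (tens_ext (f := tensR_map (idm M)) (g := id)) => //.
  exact: tensR_mapD.
by move=> m r; rewrite tensR_mapE.
Qed.

Fact tensR_mapM (M N P : Mod skew) (g : mor N P) (f : mor M N) :
  tensR_map (mcomp g f) =
  mcomp (tensR_map g : mor (tensR N : Mod invring) (tensR P)) (tensR_map f)
  :> {linear _ -> _}.
Proof.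
apply: linear_eq; apply: (tens_ext (f := tensR_map (mcomp g f))
  (g := tensR_map g \o tensR_map f)).
- exact: tensR_mapD.
- by move=> t1 t2 /=; rewrite !tensR_mapD.
- by move=> m r; rewrite /= !tensR_mapE.
Qed.

Definition tensor_functor : functor (Mod skew) (Mod invring) :=
  @Functor (Mod skew) (Mod invring) (fun M => tensR M)
    (fun M N f => tensR_map f) tensR_map1 tensR_mapM.

Section HomFunctor.
Variable N : lmodType invring^c.

Record homR : Type :=
  HomR { homR_fun :> Rr -> N; homR_linear : linear homR_fun }.
Implicit Types f g : homR.

Lemma homR_eq f g : f =1 g -> f = g.
Proof.
case: f g => [f lf] [g lg] /= fg; have {}fg : f = g by apply/funext.
by subst g; congr HomR; apply: Prop_irrelevance.
Qed.

HB.instance Definition _ := gen_eqMixin homR.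
HB.instance Definition _ := gen_choiceMixin homR.

Fact homRD f r s : f (r + s) = f r + f s.
Proof. by have := homR_linear f 1 r s; rewrite !scale1r. Qed.

Fact homR_zero_linear : linear (fun _ : Rr => 0 : N).
Proof. by move=> x r s; rewrite scaler0 addr0. Qed.
Fact homR_add_linear f g : linear (fun r : Rr => f r + g r).
Proof. by move=> x r s; rewrite !homR_linear scalerDr addrACA. Qed.
Fact homR_opp_linear f : linear (fun r : Rr => - f r).
Proof. by move=> x r s; rewrite homR_linear opprD scalerN. Qed.
Fact homR_act_linear (b : skew) f : linear (fun r : Rr => f (skew_act b r)).
Proof.
move=> x r s; rewrite -homR_linear; congr (f _).
by rewrite [LHS]skew_actDr; congr (_ + _); apply: skew_inv_act.
Qed.

Definition homR_zero : homR := HomR homR_zero_linear.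
Definition homR_add f g : homR := HomR (homR_add_linear f g).
Definition homR_opp f : homR := HomR (homR_opp_linear f).
Definition homR_act (b : skew^c) f : homR := HomR (homR_act_linear b f).

Fact homR_addA : associative homR_add.
Proof. by move=> f g h; apply: homR_eq => r; apply: addrA. Qed.
Fact homR_addC : commutative homR_add.
Proof. by move=> f g; apply: homR_eq => r; apply: addrC. Qed.
Fact homR_add0 : left_id homR_zero homR_add.
Proof. by move=> f; apply: homR_eq => r; apply: add0r. Qed.
Fact homR_addN : left_inverse homR_zero homR_opp homR_add.
Proof. by move=> f; apply: homR_eq => r; apply: addNr. Qed.

HB.instance Definition _ := GRing.isZmodule.Build homR
  homR_addA homR_addC homR_add0 homR_addN.

Fact homR_actA b c f : homR_act b (homR_act c f) = homR_act (b * c) f.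
Proof. by apply: homR_eq => r /=; congr (f _); apply: skew_actA. Qed.
Fact homR_act1 : left_id 1 homR_act.
Proof. by move=> f; apply: homR_eq => r /=; congr (f _); apply: skew_act1. Qed.
Fact homR_actDr : right_distributive homR_act +%R.
Proof. by move=> b f g; apply: homR_eq. Qed.
Fact homR_actDl f : {morph homR_act^~ f : b c / b + c}.
Proof.
by move=> b c; apply: homR_eq => r /=; rewrite [skew_act _ _]skew_actDl homRD.
Qed.

HB.instance Definition _ := GRing.Zmodule_isLmodule.Build (skew^c) homR
  homR_actA homR_act1 homR_actDr homR_actDl.
End HomFunctor.

Section HomMap.
Variables (M N : lmodType invring^c) (h : {linear M -> N}).

Fact homR_map_subproof (f : homR M) : linear (fun r : Rr => h (f r)).
Proof. by move=> x r s; rewrite homR_linear linearP. Qed.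

Definition homR_map (f : homR M) : homR N := HomR (homR_map_subproof f).

Fact homR_map_linear : linear homR_map.
Proof. by move=> b f g; apply: homR_eq => r; apply: raddfD. Qed.

HB.instance Definition _ :=
  GRing.isLinear.Build skew^c (homR M) (homR N) *:%R homR_map homR_map_linear.
End HomMap.

Fact homR_map1 (M : Mod invring) :
  homR_map (idm M) = idm (homR M : Mod skew) :> {linear _ -> _}.
Proof. by apply: linear_eq => f; apply: homR_eq. Qed.

Fact homR_mapM (M N P : Mod invring) (g : mor N P) (f : mor M N) :
  homR_map (mcomp g f) =
  mcomp (homR_map g : mor (homR N : Mod skew) (homR P)) (homR_map f)
  :> {linear _ -> _}.
Proof. by apply: linear_eq => u; apply: homR_eq. Qed.

Definition hom_functor : functor (Mod invring) (Mod skew) :=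
  @Functor (Mod invring) (Mod skew) (fun N => homR N)
    (fun M N f => homR_map f) homR_map1 homR_mapM.

End GAlgebra.

Arguments radical {k gT R} X _ : rename.
Arguments inv_radical {k gT R} X _ : rename.
Arguments skew_radical {k gT R} X _ : rename.
Arguments hom_functor {k gT R} X.
Arguments tensor_functor {k gT R} X.

(* Main.v *)
(* With c = |G|^-1 and e = c \sum_g g, the module R over the skew group      *)
(* algebra B is isomorphic to Be, so that tensoring with R amounts to        *)
(* M |-> Me. A pertinent pair of sequences a, b gives the identity           *)
(* \sum_i a_i b_i = \sum_i a_i (|G| e) b_i in B; hence multiplication by an  *)
(* element of the radical r factors on R, as a map of right A-modules,       *)
(* through a free module A^n. Consequently R behaves over A like a finitely  *)
(* generated projective module up to torsion. Together with cofinality this  *)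
(* shows that Hom_A(R, -) preserves the morphisms with torsion kernel and    *)
(* cokernel, and that the unit M -> Hom_A(R, M (x)_B R) is one of them; the  *)
(* counit Hom_A(R, N) (x)_B R -> N is even an isomorphism.                   *)

Require Import Defs.
Set Warnings "-notation-overridden,-ambiguous-paths".
Set Warnings "-redundant-canonical-projection,-projection-no-head-constant".
From HB Require Import structures.
From mathcomp Require Import all_boot all_order all_algebra all_fingroup.
From mathcomp Require Import boolp classical_sets.

Set Implicit Arguments.
Unset Strict Implicit.
Unset Printing Implicit Defensive.

Import GRing.Theory.
Local Open Scope ring_scope.
Local Notation ract := Defs.ract.

(** Let e be the averaging idempotent of B. Then R is Be, M (x)_B R is Me ([tens_valK]), and the
    counit Hom_A(R, N) (x)_B R -> N is invertible ([counit_serre_equiv]). What separates the unit M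
    -> Hom_A(R, M (x)_B R) from an isomorphism is the gap between BeB and B. Pertinence says exactly
    that b lies in (Re)B ([skew_radical_emb]), so b kills the kernel and cokernel of the unit
    ([unit_serre_equiv]).

    Both functors must also preserve morphisms with torsion kernel and cokernel. For the tensor
    functor this is read off Me ([tensor_serre_equiv]). For Hom_A(R, -) the difficulty is
    uniformity: given h : R -> N, the power of a that carries h(x) into a prescribed subset depends
    on x. Finitely many generators of r, each acting on R through a free module A^q, give one
    exponent on h(r), and cofinality turns it into a power of r ([hom_radical_pow],
    [hom_serre_equiv]).

    The functors then descend by the universal property of fractions. A quotient category has the
    same objects as the module category, so the natural isomorphisms need only be checked on module
    homomorphisms ([nat_isomorphic_fractions]). *)

Section NatIso.

(** * Natural isomorphisms between functors on categories of fractions *)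

Lemma fcompA (C D E E' : category) (H : functor E E') (G : functor D E)
    (F : functor C D) : fcomp (fcomp H G) F = fcomp H (fcomp G F).
Proof. exact: functor_eq. Qed.

Lemma fcompf1 (C D : category) (F : functor C D) : fcomp F (fid C) = F.
Proof. by case: F => *; apply: functor_eq. Qed.

Lemma fcomp1f (C D : category) (F : functor C D) : fcomp (fid D) F = F.
Proof. by case: F => *; apply: functor_eq. Qed.

Lemma nat_isomorphic_sym (C D : category) (F G : functor C D) :
  nat_isomorphic F G -> nat_isomorphic G F.
Proof.
case=> eta [/(_ _)/cid eta_iso eta_nat].
exists (fun a => sval (eta_iso a)); split=> [a|a b f].
  by case: (eta_iso a) => theta /= [te et]; exists (eta a).
case: (eta_iso a) (eta_iso b) => ta [_ et] [tb [te _]] /=.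
rewrite -[LHS]compm1 -et -compmA (compmA (fmap G f)) -eta_nat.
by rewrite !compmA te comp1m.
Qed.

Lemma nat_isomorphic_proj (C D : category)
    (W : forall a b : D, mor a b -> Prop) (F G : functor C D)
    (eta : forall a, mor (F a) (G a)) :
  (forall a b (f : mor a b),
     mcomp (eta b) (fmap F f) = mcomp (fmap G f) (eta a)) ->
  (forall a, W _ _ (eta a)) ->
  nat_isomorphic (fcomp (frac_proj W) F) (fcomp (frac_proj W) G).
Proof.
move=> eta_nat etaW; exists (fun a => fmap (frac_proj W) (eta a)); split.
  by move=> a; apply/frac_proj_iso/etaW.
by move=> a b f /=; rewrite -[LHS]frac_mapM -[RHS]frac_mapM eta_nat.
Qed.

(** The same components serve, since the projection is the identity on objects. Naturality is
    checked along a zigzag, one generator at a time. *)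
Lemma nat_isomorphic_fractions (C D : category)
    (W : forall a b : C, mor a b -> Prop) (F G : functor (fractions W) D) :
  nat_isomorphic (fcomp F (frac_proj W)) (fcomp G (frac_proj W)) ->
  nat_isomorphic F G.
Proof.
case=> eta [eta_iso eta_nat]; exists eta; split=> // a b f.
have {f} [z ->] : exists z, f = frac_cls z.
  by exists (qrep f); rewrite -{1}(qrepK f).
elim: z => [|x y g z IH|x y w Ww z IH].
- by rewrite [fmap F _](fmap1 F b) [fmap G _](fmap1 G b) comp1m compm1.
- have -> : frac_cls (zfwd g z) =
      @mcomp (fractions W) _ _ _ (frac_cls z) (frac_map W g).
    by rewrite /= frac_comp_cls.
  by rewrite !fmapM compmA IH -compmA [mcomp (eta y) _]eta_nat !compmA.
have -> : frac_cls (zbwd Ww z) =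
    @mcomp (fractions W) _ _ _ (frac_cls z) (frac_cls (zbwd Ww (znil _ _))).
  by rewrite /= frac_comp_cls.
rewrite !fmapM compmA IH -!compmA; congr mcomp.
set v := frac_cls _.
have vw : @mcomp (fractions W) _ _ _ v (frac_map W w) =
    @Defs.idm (fractions W) y.
  by rewrite /= frac_comp_cls; apply/frac_clsE/zeq_fwdK.
have wv : @mcomp (fractions W) _ _ _ (frac_map W w) v =
    @Defs.idm (fractions W) x.
  by rewrite /= frac_comp_cls; apply/frac_clsE/zeq_bwdK.
(* Inserting the image under G of v w = id on the left carries the naturality square of w over to
   its inverse v. *)
have /= eta_w := eta_nat _ _ w.
rewrite -[LHS]comp1m -(fmap1 G) -vw fmapM -!compmA; congr mcomp.
rewrite (compmA (fmap G _)) -eta_w -compmA -fmapM.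
by rewrite (_ : mcomp _ _ = @Defs.idm (fractions W) x) // fmap1 compm1.
Qed.

End NatIso.

(** * Kernels, cokernels and Serre equivalences in terms of elements *)

Section SerreEquiv.
Variables (S : pzRingType) (M N : lmodType S^c) (f : {linear M -> N}).

Definition ker_pred : {pred M} := [pred m | f m == 0].

Fact ker_pred_closed : GRing.subsemimod_closed ker_pred.
Proof.
split; first split.
- by rewrite unfold_in /= linear0.
- by move=> x y /eqP fx /eqP fy; rewrite unfold_in /= linearD fx fy addr0.
- by move=> a x /eqP fx; rewrite unfold_in /= linearZ /= fx scaler0.
Qed.

HB.instance Definition _ := GRing.isSubmodClosed.Build S^c M ker_pred
  ker_pred_closed.

Record ker_mod : Type := KerMod { ker_val : M; _ : ker_val \in ker_pred }.

HB.instance Definition _ := [isSub for ker_val].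
HB.instance Definition _ := [Choice of ker_mod by <:].
HB.instance Definition _ := [SubChoice_isSubLmodule of ker_mod by <:].

Lemma ker_val_kernel : is_kernel f (val : {linear ker_mod -> M}).
Proof.
split; first exact: val_inj.
move=> m; split=> [/eqP fm0|[[x x_ker] <-]]; first by exists (KerMod fm0).
exact/eqP.
Qed.

Definition coker_rel (x y : N) : Prop := exists m, f m = x - y.

Fact coker_refl x : coker_rel x x.
Proof. by exists 0; rewrite linear0 subrr. Qed.
Fact coker_sym x y : coker_rel x y -> coker_rel y x.
Proof. by case=> m fm; exists (- m); rewrite linearN /= fm opprB. Qed.
Fact coker_trans x y z : coker_rel x y -> coker_rel y z -> coker_rel x z.
Proof.
by case=> m fm [n fn]; exists (m + n); rewrite linearD fm fn addrA subrK.
Qed.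

Definition coker_mod : Type := quot coker_rel.

HB.instance Definition _ := gen_eqMixin coker_mod.
HB.instance Definition _ := gen_choiceMixin coker_mod.

Definition coker_proj (n : N) : coker_mod := qcls coker_rel n.

Lemma coker_projP x y : coker_proj x = coker_proj y <-> coker_rel x y.
Proof.
split=> [|xy]; first by apply: qcls_inj; apply: coker_refl.
by apply: qcls_eq xy; [apply: coker_sym | apply: coker_trans].
Qed.

Lemma coker_ind (Q : coker_mod -> Prop) :
  (forall n, Q (coker_proj n)) -> forall c, Q c.
Proof. by move=> Qp c; rewrite -(qrepK c); apply: Qp. Qed.

Definition coker_add (c d : coker_mod) := coker_proj (qrep c + qrep d).
Definition coker_opp (c : coker_mod) := coker_proj (- qrep c).
Definition coker_scale (a : S^c) (c : coker_mod) := coker_proj (a *: qrep c).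

Fact coker_rep n : coker_rel (qrep (coker_proj n)) n.
Proof. by apply/coker_projP; rewrite /coker_proj qrepK. Qed.

Lemma coker_addE x y :
  coker_add (coker_proj x) (coker_proj y) = coker_proj (x + y).
Proof.
apply/coker_projP; have [m fm] := coker_rep x; have [n fn] := coker_rep y.
by exists (m + n); rewrite linearD fm fn opprD addrACA.
Qed.

Lemma coker_oppE x : coker_opp (coker_proj x) = coker_proj (- x).
Proof.
apply/coker_projP; have [m fm] := coker_rep x.
by exists (- m); rewrite linearN /= fm opprD.
Qed.

Lemma coker_scaleE a x : coker_scale a (coker_proj x) = coker_proj (a *: x).
Proof.
apply/coker_projP; have [m fm] := coker_rep x.
by exists (a *: m); rewrite linearZ /= fm scalerBr.
Qed.

Fact coker_addA : associative coker_add.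
Proof.
by elim/coker_ind=> x; elim/coker_ind=> y; elim/coker_ind=> z;
   rewrite !coker_addE addrA.
Qed.
Fact coker_addC : commutative coker_add.
Proof.
by elim/coker_ind=> x; elim/coker_ind=> y; rewrite !coker_addE addrC.
Qed.
Fact coker_add0 : left_id (coker_proj 0) coker_add.
Proof. by elim/coker_ind=> x; rewrite coker_addE add0r. Qed.
Fact coker_addN : left_inverse (coker_proj 0) coker_opp coker_add.
Proof. by elim/coker_ind=> x; rewrite coker_oppE coker_addE addNr. Qed.

HB.instance Definition _ := GRing.isZmodule.Build coker_mod
  coker_addA coker_addC coker_add0 coker_addN.

Fact coker_scaleA a b c :
  coker_scale a (coker_scale b c) = coker_scale (a * b) c.
Proof. by elim/coker_ind: c => x; rewrite !coker_scaleE scalerA. Qed.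
Fact coker_scale1 : left_id 1 coker_scale.
Proof. by elim/coker_ind=> x; rewrite coker_scaleE scale1r. Qed.
Fact coker_scaleDr : right_distributive coker_scale +%R.
Proof.
by move=> a; elim/coker_ind=> x; elim/coker_ind=> y;
   rewrite [X in coker_scale a X]coker_addE !coker_scaleE [RHS]coker_addE
     scalerDr.
Qed.
Fact coker_scaleDl c : {morph coker_scale^~ c : a b / a + b}.
Proof.
move=> a b; elim/coker_ind: c => x.
by rewrite !coker_scaleE [RHS]coker_addE scalerDl.
Qed.

HB.instance Definition _ := GRing.Zmodule_isLmodule.Build S^c coker_mod
  coker_scaleA coker_scale1 coker_scaleDr coker_scaleDl.

Fact coker_proj_linear : linear coker_proj.
Proof. by move=> a x y; rewrite -coker_addE -coker_scaleE. Qed.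

HB.instance Definition _ :=
  GRing.isLinear.Build S^c N coker_mod *:%R coker_proj coker_proj_linear.

Lemma coker_proj_eq0 n : coker_proj n = 0 <-> exists m, f m = n.
Proof.
by rewrite -[0]/(coker_proj 0) coker_projP /coker_rel subr0.
Qed.

Lemma coker_proj_cokernel :
  is_cokernel f (coker_proj : {linear N -> coker_mod}).
Proof.
split; last exact: coker_proj_eq0.
by elim/coker_ind=> n; exists n.
Qed.

(** Torsion of kernel and cokernel becomes a condition on single elements, with an exponent that may
    vary from one element to the next. The converse direction needs an actual kernel and cokernel,
    hence [ker_mod] and [coker_mod]. *)
Lemma serre_equivP (s : set S) :
  serre_equiv s (f : mor (M : Mod S) (N : Mod S)) <->
  (forall m, f m = 0 -> Gamma s m) /\
  (forall n, exists k, forall x, ideal_pow s k x -> exists m, f m = ract n x).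
Proof.
split=> [[K [C [i [p [[_ ker_i] [_ ker_p] torK torC]]]]]|[tor_ker tor_coker]].
  split=> [m /ker_i[x <-]|n].
    have : [set: K]%classic x by [].
    rewrite -torK => -[k kx]; exists k => y /kx yx.
    by rewrite /ract -linearZ [X in i X]yx linear0.
  have : [set: C]%classic (p n) by [].
  rewrite -torC => -[k kx]; exists k => y /kx yn; apply/ker_p.
  by rewrite linearZ.
exists ker_mod, coker_mod, (val : {linear ker_mod -> M}).
exists (coker_proj : {linear N -> coker_mod}); split.
- exact: ker_val_kernel.
- exact: coker_proj_cokernel.
- apply/funext => x; apply/propext; split=> // _.
  have [|k kx] := tor_ker (val x); first by apply/eqP; case: x.
  by exists k => y /kx xy; apply: val_inj; rewrite [LHS]linearZ [LHS]xy linear0.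
- apply/funext => c; apply/propext; split=> // _; elim/coker_ind: c => n.
  have [k kn] := tor_coker n; exists k => x /kn /coker_proj_eq0.
  by rewrite linearZ.
Qed.

End SerreEquiv.

(** * Uniform exponents and powers of ideals *)

Lemma exists_uniform n (Q : 'I_n -> nat -> Prop) :
  (forall i k l, (k <= l)%N -> Q i k -> Q i l) -> (forall i, exists k, Q i k) ->
  exists k, forall i, Q i k.
Proof.
move=> Qmono /(_ _)/cid Qex; exists (\max_i sval (Qex i)) => i.
by apply: Qmono (svalP (Qex i)); apply: leq_bigmax.
Qed.

Section IdealPowers.
Variable S : pzRingType.
Implicit Types I J P : set S.

Lemma mulset_mul I J x y : I x -> J y -> mulset I J (x * y).
Proof.
move=> Ix Jy; exists 1, (fun=> x), (fun=> y).
by rewrite big_ord_recl big_ord0 addr0.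
Qed.

Lemma mulset0 I J : mulset I J 0.
Proof.
by exists 0, (fun=> 0), (fun=> 0); rewrite big_ord0; split=> // -[].
Qed.

Lemma mulsetD I J x y : mulset I J x -> mulset I J y -> mulset I J (x + y).
Proof.
case=> [n [a [b [Ia Jb ->]]]] [p [c [d [Ic Jd ->]]]].
pose glue (u : 'I_n -> S) (v : 'I_p -> S) (i : 'I_(n + p)) :=
  match split i with inl j => u j | inr j => v j end.
exists (n + p), (glue a c), (glue b d); rewrite /glue; split.
- by move=> i; case: split.
- by move=> i; case: split.
rewrite big_split_ord; congr (_ + _); apply: eq_bigr => i _.
  by rewrite (unsplitK (inl i : 'I_n + 'I_p)).
by rewrite (unsplitK (inr i : 'I_n + 'I_p)).
Qed.

Lemma mulset_ind I J P :
  P 0 -> (forall x y, P x -> P y -> P (x + y)) ->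
  (forall x y, I x -> J y -> P (x * y)) -> forall z, mulset I J z -> P z.
Proof.
move=> P0 PD PM _ [n [x [y [Ix Jy ->]]]].
by elim/big_ind: _ => // i _; apply: PM.
Qed.

Lemma right_ideal_mulset I J : right_ideal J -> right_ideal (mulset I J).
Proof.
case=> _ _ JM; split; [exact: mulset0 | exact: mulsetD | move=> x c].
move: x; apply: mulset_ind => [|x y|x y Ix Jy].
- by rewrite mul0r; apply: mulset0.
- by rewrite mulrDl; apply: mulsetD.
- by rewrite -mulrA; apply/mulset_mul/JM.
Qed.

Lemma left_ideal_mulset I J : left_ideal I -> left_ideal (mulset I J).
Proof.
case=> _ _ IM; split; [exact: mulset0 | exact: mulsetD | move=> c].
apply: mulset_ind => [|x y|x y Ix Jy].
- by rewrite mulr0; apply: mulset0.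
- by rewrite mulrDr; apply: mulsetD.
- by rewrite mulrA; apply: mulset_mul => //; apply: IM.
Qed.

Lemma ideal_pow_left I n : left_ideal (ideal_pow I n).
Proof. by elim: n => [|n IH]; [split | apply: left_ideal_mulset]. Qed.

Lemma ideal_pow_right I n : right_ideal I -> right_ideal (ideal_pow I n).
Proof. by case: n => [|n] Ir; [split | apply: right_ideal_mulset]. Qed.

Lemma ideal_pow_le I m n x : right_ideal I ->
  (m <= n)%N -> ideal_pow I n x -> ideal_pow I m x.
Proof.
move=> Ir /subnK <-; elim: (n - m)%N x => // p IH x.
have [p0 pD pM] := ideal_pow_right (p + m) Ir.
rewrite addSn => px; apply: IH; move: x px.
by apply: mulset_ind => // x y px _; apply: pM.
Qed.

(** [ideal_pow] multiplies new factors on the right; this splits one off on the left. *)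
Lemma ideal_powSl I n x : left_ideal I ->
  ideal_pow I n.+1 x -> mulset I (ideal_pow I n) x.
Proof.
case=> _ _ IM; elim: n x => [|n IH] x.
  move: x; apply: mulset_ind; [exact: mulset0 | exact: mulsetD |].
  move=> x y _ Iy.
  by rewrite -[x * y]mulr1; apply: mulset_mul => //; apply: IM.
move: x; apply: mulset_ind; [exact: mulset0 | exact: mulsetD | move=> x y].
move=> /IH + Iy; move: x; apply: mulset_ind => [|x1 x2|u v Iu Iv].
- by rewrite mul0r; apply: mulset0.
- by rewrite mulrDl; apply: mulsetD.
- by rewrite -mulrA; apply: mulset_mul => //; apply: mulset_mul.
Qed.

(** Because this conductor is a right ideal, cokernel torsion need only be tested on the generators
    [emb a] of the right ideals in [skew_pow_emb]. *)
Lemma right_ideal_preim_image (M N : lmodType S^c) (f : {linear M -> N}) n :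
  right_ideal (fun x => exists m, f m = ract n x).
Proof.
split=> [|x y [m fm] [p fp]|x c [m fm]].
- by exists 0; rewrite linear0 /ract scale0r.
- by exists (m + p); rewrite linearD /= fm fp /ract scalerDl.
- by exists (ract m c); rewrite linearZ /= fm /ract scalerA.
Qed.

End IdealPowers.

(** * The G-radical and its powers in R, A and B *)

Section SkewGroupAlgebra.
Variables (k : fieldType) (gT : finGroupType) (R : algType k).
Variable X : galgebra gT R.
Local Notation skew := (Defs.skew X).
Local Notation invring := (invring X).
Local Notation Rl := (Rl X).
Local Notation Rr := (Rr X).
Local Notation inv_val := (@inv_val k gT R X).

Lemma radical_ideal : left_ideal (radical X) /\ right_ideal (radical X).
Proof.
have rad0 : radical X 0.
  exists 1, (fun=> 0), (fun=> 0); split=> [//|g _|].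
    by rewrite big1 // => i _; rewrite mul0r.
  by rewrite big1 // => i _; rewrite mul0r.
have radD x y : radical X x -> radical X y -> radical X (x + y).
  case=> [n [a [b [n0 ab ->]]]] [p [c [d [p0 cd ->]]]].
  pose glue (u : 'I_n -> R) (v : 'I_p -> R) (i : 'I_(n + p)) :=
    match split i with inl j => u j | inr j => v j end.
  have glueE (h : R -> R) : \sum_i glue a c i * h (glue b d i) =
      \sum_i a i * h (b i) + \sum_i c i * h (d i).
    rewrite big_split_ord; congr (_ + _); apply: eq_bigr => i _; rewrite /glue.
      by rewrite (unsplitK (inl i : 'I_n + 'I_p)).
    by rewrite (unsplitK (inr i : 'I_n + 'I_p)).
  exists (n + p), (glue a c), (glue b d); split; first by rewrite addn_gt0 n0.
    by move=> g g1; rewrite glueE ab // cd // addr0.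
  by rewrite (glueE id).
suff radM z x : radical X x -> radical X (z * x) /\ radical X (x * z).
  by split; split=> // x y; [move=> /(radM x)[] | move=> /(radM y)[]].
case=> n [a [b [n0 ab ->]]]; split.
  exists n, (fun i => z * a i), b; split=> // [g g1|]; last first.
    by rewrite mulr_sumr; apply: eq_bigr => i _; rewrite mulrA.
  have := congr1 (fun t => z * t) (ab g g1); rewrite mulr0 mulr_sumr => E.
  by rewrite -[RHS]E; apply: eq_bigr => i _; rewrite mulrA.
exists n, a, (fun i => b i * z); split=> // [g g1|]; last first.
  by rewrite mulr_suml; apply: eq_bigr => i _; rewrite mulrA.
have := congr1 (fun t => t * X g z) (ab g g1); rewrite mul0r mulr_suml => E.
by rewrite -[RHS]E; apply: eq_bigr => i _; rewrite rmorphM mulrA.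
Qed.

Lemma radical_act g x : radical X x -> radical X (X g x).
Proof.
case=> n [a [b [n0 ab ->]]].
exists n, (fun i => X g (a i)), (fun i => X g (b i)); split=> // [h h1|].
  (* Since h g = g (h ^ g), the sum at h is g applied to the sum of the original pair at h ^ g,
     which is again nontrivial. *)
  have /(congr1 (X g)) : \sum_i a i * X (h ^ g)%g (b i) = 0.
    by apply: ab; rewrite conjg_eq1.
  rewrite rmorph0 rmorph_sum => E; rewrite -[RHS]E.
  apply: eq_bigr => i _; rewrite rmorphM.
  congr (_ * _).
  by rewrite -[LHS](Defs.gactM X h g) -[RHS](Defs.gactM X g) -conjgC.
by rewrite rmorph_sum; apply: eq_bigr => i _; rewrite rmorphM.
Qed.

Lemma inv_radical_ideal :
  left_ideal (inv_radical X) /\ right_ideal (inv_radical X).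
Proof.
have [[r0 rD rMl] [_ _ rMr]] := radical_ideal.
by split; split=> // x y; [apply: rD|apply: rMl|apply: rD|apply: rMr].
Qed.

(** A product in B twists the coefficients of its right factor by G, and the radical is G-stable
    ([radical_act]). *)
Lemma skew_pow_coef n b g :
  ideal_pow (skew_radical X) n b -> ideal_pow (radical X) n (b g).
Proof.
move=> bn; elim: n b bn g => // n IH b bn g; move: b bn.
have [rp0 rpD _] := ideal_pow_left (radical X) n.+1.
apply: mulset_ind => [|x y xr yr|x y /IH xn yr]; rewrite ?ffunE //.
  exact: rpD.
elim/big_ind: _ => // u _; apply: mulset_mul; first exact: xn.
exact/radical_act/yr.
Qed.

Lemma skew_pow_act n (b : skew) x :
  ideal_pow (skew_radical X) n b -> ideal_pow (radical X) n (skew_act b x).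
Proof.
move=> bn; have [_ rr] := radical_ideal.
have [rp0 rpD rpM] := ideal_pow_right n rr.
by rewrite /skew_act; elim/big_ind: _ => // u _; apply/rpM/skew_pow_coef.
Qed.

Lemma skew_eltD r s g : skew_elt X (r + s) g = skew_elt X r g + skew_elt X s g.
Proof. by apply/ffunP => h; rewrite !ffunE mulrnDl. Qed.

Lemma skew_pow_inv n (x : invring) :
  ideal_pow (inv_radical X) n x ->
  ideal_pow (skew_radical X) n (skew_elt X (inv_val x) 1%g).
Proof.
elim: n x => // n IH; have [p0 pD _] := ideal_pow_left (skew_radical X) n.+1.
have s0 : skew_elt X 0 1%g = 0 by apply/ffunP => h; rewrite !ffunE mul0rn.
apply: mulset_ind => [|x y xn yn|x y /IH xn yr].
- by rewrite [X in skew_elt _ X](_ : _ = 0) ?s0.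
- by rewrite [skew_elt _ _ _](skew_eltD (inv_val x) (inv_val y)); apply: pD.
have -> : skew_elt X (inv_val (x * y)) 1%g =
    skew_elt X (inv_val x) 1%g * skew_elt X (inv_val y) 1%g.
  by rewrite skew_eltM mulg1 Defs.gact1.
apply: mulset_mul => // g; rewrite ffunE.
have [[r0 _ _] _] := radical_ideal.
by case: eqP => _; rewrite ?mulr0n ?mulr1n.
Qed.

(** * The idempotent e, averaging, and powers of b inside (Re)B *)

Hypothesis charkG : [pchar k]^'.-nat #|gT|.

Let c : k := #|gT|%:R^-1.

Lemma card_neq0 : #|gT|%:R != 0 :> k.
Proof.
by rewrite natf_neq0_pchar.
Qed.

(* emb 1 is the idempotent e, and emb x is xe.                              *)
Definition emb (x : R) : skew := [ffun=> c *: x].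

Lemma mul_emb (b : skew) x : b * emb x = emb (skew_act b x).
Proof.
apply/ffunP => h; rewrite !ffunE scaler_sumr; apply: eq_bigr => g _.
by rewrite ffunE linearZ scalerAr.
Qed.

Lemma embD : {morph emb : x y / x + y}.
Proof. by move=> x y; apply/ffunP => h; rewrite !ffunE scalerDr. Qed.

Fact avg_invariant (x : R) : skew_act (emb 1) x \in ginvariant X.
Proof.
apply/ginvariantP => g; rewrite /skew_act rmorph_sum.
rewrite [RHS](reindex_inj (mulgI g)).
apply: eq_bigr => h _ /=; rewrite !ffunE.
by rewrite rmorphM /= linearZ /= rmorph1 Defs.gactM.
Qed.

(** This is the action of e on x, the normalised trace from R onto A. *)
Definition avg (x : R) : invring := InvRing (avg_invariant x).

Lemma act_emb (a x : R) : skew_act (emb a) x = a * inv_val (avg x).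
Proof.
rewrite /= /skew_act mulr_sumr; apply: eq_bigr => g _.
by rewrite !ffunE mulrA -scalerAr mulr1.
Qed.

Lemma avgD : {morph avg : x y / x + y}.
Proof. by move=> x y; apply: val_inj; apply: skew_actDr. Qed.

Lemma avg_inv_act a (x : Rr) : avg (inv_act a x) = avg x * a.
Proof. by apply: val_inj; apply: skew_inv_act. Qed.

Lemma avg1 : avg 1 = 1.
Proof.
apply: val_inj; rewrite /= /skew_act.
under eq_bigr do rewrite ffunE rmorph1 mulr1.
by rewrite sumr_const -scaler_nat scalerA mulfV ?card_neq0 ?scale1r.
Qed.

Lemma skew_radical_emb (b : skew) :
  skew_radical X b -> mulset (range emb) setT b.
Proof.
move=> br; have -> : b = \sum_g skew_elt X (b g) g.
  apply/ffunP => h; rewrite sum_ffunE (bigD1 h) //= big1 => [|g gh].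
    by rewrite ffunE eqxx addr0.
  by rewrite ffunE eq_sym (negbTE gh).
elim/big_ind: _ => [||g _]; [exact: mulset0 | exact: mulsetD |].
have [n [u [v [_ uv ->]]]] := br g.
(* The factor c^-1 = |G| cancels the c in [emb]. The coefficient of the right side at h is then the
   pertinence sum at h g^-1, which vanishes unless h = g. *)
have -> : skew_elt X (\sum_i u i * v i) g =
    \sum_i emb (c^-1 *: u i) * skew_elt X (v i) g.
  apply/ffunP => h; rewrite sum_ffunE !ffunE.
  transitivity (\sum_i u i * X (h * g^-1)%g (v i)).
    have [->|hg] := eqVneq h g.
      by rewrite mulgV; apply: eq_bigr => i _; rewrite Defs.gact1.
    by rewrite uv // -eq_mulgV1.
  apply: eq_bigr => i _; rewrite ffunE (bigD1 (h * g^-1)%g) //= big1 ?addr0.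
    by rewrite !ffunE scalerA mulfV ?invr_neq0 ?card_neq0 // scale1r invMg invgK
               mulgKV eqxx.
  move=> w wh; rewrite !ffunE.
  rewrite (_ : (w^-1 * h == g)%g = false) ?rmorph0 ?mulr0 //.
  by apply: contra_neqF wh => /eqP <-; rewrite invMg invgK mulKVg.
elim/big_ind: _ => [||i _]; [exact: mulset0 | exact: mulsetD |].
by apply: mulset_mul => //; exists (c^-1 *: u i).
Qed.

(** Write an element of b^(n+1) through products x y with x in b^n and y in b. Then y is a sum of
    terms (ae)v, and x(ae) = (x.a)e with x.a in r^n. *)
Lemma skew_pow_emb n (b : skew) : ideal_pow (skew_radical X) n.+1 b ->
  mulset (emb @` ideal_pow (radical X) n)%classic setT b.
Proof.
move: b; apply: mulset_ind; [exact: mulset0 | exact: mulsetD | move=> x y xn].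
move=> /skew_radical_emb; move: y; apply: mulset_ind => [|u v|_ v [a _ <-] _].
- by rewrite mulr0; apply: mulset0.
- by rewrite mulrDr; apply: mulsetD.
rewrite mulrA mul_emb; apply: mulset_mul => //.
by exists (skew_act x a) => //; apply: skew_pow_act.
Qed.

(** * Tensoring with R as passage from M to Me *)

Section TensorInvariants.
Variable M : lmodType skew^c.

Definition tens_val (t : tensR M) : M :=
  tens_lift (fun m (x : Rl) => ract m (emb x)) t.

Fact tens_val_bal : balanced (fun (m : M) (x : Rl) => ract m (emb x)).
Proof.
split=> [m1 m2 x|m x y|m b x]; first exact: scalerDr.
  by rewrite embD; apply: scalerDl.
by rewrite -mul_emb /ract scalerA.
Qed.

Lemma tens0l (x : Rl) : tens (0 : M) x = 0 :> tensR M.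
Proof. by apply: (addrI (tens 0 x)); rewrite -[LHS]tensDl !addr0. Qed.

Lemma tens_valE m x : tens_val (tens m x) = ract m (emb x).
Proof. exact/tens_liftE/tens_val_bal. Qed.

Lemma tens_valD : {morph tens_val : t u / t + u}.
Proof. by move=> t u; apply/tens_liftD/tens_val_bal. Qed.

Lemma tens_val0 : tens_val 0 = 0.
Proof. by apply: (addrI (tens_val 0)); rewrite -tens_valD !addr0. Qed.

Lemma act_emb1 (x : R) : skew_act (emb x) 1 = x.
Proof. by rewrite act_emb avg1 // mulr1. Qed.

Lemma tens_act1 (m : M) (b : skew) :
  tens m (skew_act b 1) = tens (ract m b) (1 : Rl) :> tensR M.
Proof. by rewrite tensZ. Qed.

(** Because x = (xe).1, every tensor m (x) x equals m(xe) (x) 1. So every tensor is pure, and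
    [tens_val] embeds the tensor product into M. *)
Lemma tens_valK t : tens (tens_val t) (1 : Rl) = t.
Proof.
apply: (tens_ext (f := fun t => tens (tens_val t) (1 : Rl)) (g := id)) => //.
  by move=> u v; rewrite tens_valD tensDl.
by move=> m x; rewrite tens_valE -tens_act1 act_emb1.
Qed.

Lemma tens_val_act t (x : invring) :
  ract (t : tensR M) x =
  tens (ract (tens_val t) (skew_elt X (inv_val x) 1%g)) (1 : Rl).
Proof.
rewrite -{1}(tens_valK t) [LHS]tensR_actE -tens_act1; congr (tens _ _).
rewrite /inv_act /skew_act mul1r (bigD1 1%g) //= big1 ?addr0 => [|g g1].
  by rewrite ffunE eqxx rmorph1 mulr1.
by rewrite ffunE (negbTE g1) mul0r.
Qed.

End TensorInvariants.

Lemma tens_val_map (M N : lmodType skew^c) (f : {linear M -> N}) t :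
  tens_val (tensR_map f t) = f (tens_val t).
Proof.
apply: (tens_ext (f := fun t => tens_val (tensR_map f t))
  (g := fun t => f (tens_val t))).
- by move=> u v; rewrite tensR_mapD tens_valD.
- by move=> u v; rewrite tens_valD linearD.
- by move=> m x; rewrite tensR_mapE !tens_valE /ract linearZ.
Qed.

(** Under [tens_val], x in A acts as x (x) 1 in B, and this sends a^n into b^n ([skew_pow_inv]).
    Exponents valid for f are therefore valid for its image. *)
Lemma tensor_serre_equiv (M N : Mod skew) (f : mor M N) :
  serre_equiv (skew_radical X) f ->
  serre_equiv (inv_radical X) (fmap (tensor_functor X) f).
Proof.
move=> /serre_equivP[tor_ker tor_coker]; apply/serre_equivP; split=> [t ft|t].
  have [|n tn] := tor_ker (tens_val t).
    by rewrite -tens_val_map [tensR_map f t]ft tens_val0.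
  exists n => x /skew_pow_inv xn; by rewrite tens_val_act tn // tens0l.
have [n tn] := tor_coker (tens_val t).
exists n => x /skew_pow_inv /tn[m fm]; exists (tens m (1 : Rl)).
by rewrite [LHS]tensR_mapE fm tens_val_act.
Qed.

(** * The B-module Hom_A(R, N) and the action of Re on it *)

Lemma homR0 (N : lmodType invring^c) (h : homR N) : h 0 = 0.
Proof. by apply: (addrI (h 0)); rewrite -homRD !addr0. Qed.

Lemma homR_inv_act (N : lmodType invring^c) (h : homR N) (a : invring) x :
  h (inv_act a x) = ract (h x) a.
Proof. by have := homR_linear h a x 0; rewrite homR0 !addr0. Qed.

Section HomAvg.
Variable N : lmodType invring^c.

Fact hom_avg_linear (n : N) : linear (fun x : Rr => ract n (avg x)).
Proof.
move=> a x y; rewrite avgD [avg _]avg_inv_act /ract scalerA.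
exact: scalerDl.
Qed.

Definition hom_avg (n : N) : homR N := HomR (hom_avg_linear n).

(** Since (ae).x = a avg(x) and avg(x) lies in A, the map h(ae) depends only on the value h(a). *)
Lemma ract_hom_emb (h : homR N) (a : R) : ract h (emb a) = hom_avg (h a).
Proof.
by apply: homR_eq => x; rewrite /= act_emb -homR_inv_act.
Qed.

End HomAvg.

Lemma hom_avg_map (M N : lmodType invring^c) (f : {linear M -> N}) m :
  homR_map f (hom_avg m) = hom_avg (f m).
Proof. by apply: homR_eq => x; rewrite /= /ract linearZ. Qed.

(** * Uniform exponents for A-linear maps on R, from cofinality *)

Section Cofinal.
Hypotheses (Rnoeth : noetherian R)
  (cofinal_ar : cofinal (inv_radical X) (radical X)).

Local Notation inv_pow := (ideal_pow (inv_radical X)).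

(** Iterating aR = Ra moves a^n past R from left to right. *)
Lemma inv_pow_swap n u x : inv_pow n u ->
  mulset setT (inv_val @` inv_pow n)%classic (inv_val u * x).
Proof.
elim: n u x => [|n IH] u x un.
  by rewrite -[_ * x]mulr1; apply: mulset_mul => //; exists 1.
move: u un; apply: mulset_ind => [|u v|u v un vr].
- by rewrite [inv_val 0 * x]mul0r; apply: mulset0.
- by rewrite [inv_val (u + v) * x]mulrDl; apply: mulsetD.
have : mulset setT (inv_val @` inv_radical X)%classic (inv_val v * x).
  by case: cofinal_ar => <- _; apply: mulset_mul => //; exists v.
have -> : inv_val (u * v) * x = inv_val u * (inv_val v * x) by rewrite mulrA.
move: (inv_val v * x); apply: mulset_ind => [|y z|s _ _ [t tr <-]].
- by rewrite mulr0; apply: mulset0.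
- by rewrite mulrDr; apply: mulsetD.
rewrite mulrA; have := IH u s un; move: (inv_val u * s).
apply: mulset_ind => [|y z|y _ _ [w wn <-]].
- by rewrite mul0r; apply: mulset0.
- by rewrite mulrDl; apply: mulsetD.
rewrite -mulrA; apply: mulset_mul => //; exists (w * t) => //.
exact: mulset_mul.
Qed.

Variables (N : lmodType invring^c) (P : N -> Prop) (h : homR N).
Hypotheses (P0 : P 0) (PD : forall x y, P x -> P y -> P (x + y)).
Hypothesis hP : forall x, exists n, forall a, inv_pow n a -> P (ract (h x) a).

(** P stands for the zero submodule or the image of a homomorphism. The right ideal r has finitely
    many generators, and on each the values of h are governed by finitely many values h(w_j), so
    finitely many exponents suffice. *)
Lemma hom_radical_pow_aux :
  exists n, forall y a, radical X y -> inv_pow n a -> P (ract (h y) a).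
Proof.
have [_ rr] := radical_ideal; have [_ al] := inv_radical_ideal.
have [p [r rE]] := Rnoeth.2 _ rr.
pose Q (y : R) n := forall x a, inv_pow n a -> P (ract (h (y * x)) a).
have Qle y m n : (m <= n)%N -> Q y m -> Q y n.
  by move=> mn Qy x a an; apply/Qy/(ideal_pow_le al mn).
have [i|n Qn] := @exists_uniform p (Q \o r) (fun i => @Qle (r i)).
  have : radical X (r i).
    apply/rE; exists (fun j => (j == i)%:R).
    rewrite (bigD1 i) //= eqxx mulr1 big1 ?addr0 // => j /negbTE->.
    by rewrite mulr0.
  move=> ri; have : mulset (range emb) setT (skew_elt X (r i) 1%g).
    apply: skew_radical_emb => g; rewrite ffunE.
    by case: eqP => _; rewrite ?mulr1n ?mulr0n //; case: rr.
  case=> q [u [v [u_emb _ rE']]].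
  pose w j : R := sval (cid2 (u_emb j)).
  have uE j : u j = emb (w j) by rewrite /w; case: cid2.
  (* Multiplication by r_i factors through A^q: the averages are right A-linear coordinates of x,
     and the w_j are the images of the basis vectors. *)
  have rx x : r i * x = \sum_j w j * inv_val (avg (skew_act (v j) x)).
    transitivity (skew_act (skew_elt X (r i) 1%g) x).
      rewrite /skew_act (bigD1 1%g) //= big1 ?addr0 => [|g g1].
        by rewrite ffunE eqxx mulr1n Defs.gact1.
      by rewrite ffunE (negbTE g1) mul0r.
    rewrite rE' [LHS](scaler_suml (x : Rl)).
    apply: eq_bigr => j _.
    by rewrite [LHS](esym (skew_actA _ _ _)) uE act_emb.
  have [j m n mn Qm a an|j|n wn] := @exists_uniform q
    (fun j n => forall a, inv_pow n a -> P (ract (h (w j)) a)).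
  - exact/Qm/(ideal_pow_le al mn).
  - exact: hP.
  exists n => x a an; rewrite rx (big_morph h (homRD h) (homR0 h)).
  rewrite /ract scaler_sumr.
  elim/big_ind: _ => // j _.
  rewrite [h _](homR_inv_act h _ (w j)) scalerA.
  (* The coordinate of x stands to the left of a and is absorbed, a^n being a left ideal. *)
  by apply: wn; case: (ideal_pow_left (inv_radical X) n) => _ _; apply.
exists n => y a /rE[d ->] an; rewrite (big_morph h (homRD h) (homR0 h)).
rewrite /ract scaler_sumr.
by elim/big_ind: _ => // i _; apply: Qn.
Qed.

Lemma hom_radical_pow :
  exists n, forall y, ideal_pow (radical X) n y -> P (h y).
Proof.
have [[_ _ rMl] [r0 rD rMr]] := radical_ideal.
have [n hn] := hom_radical_pow_aux.
(* The additional factor stays on the left: r r^m lies in r a^n R, hence in r R a^n, hence in r a^n,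
   where the previous bound applies. *)
have [m rm] := cofinal_ar.2 n; exists m.+1 => y.
move=> /(ideal_powSl (And3 r0 rD rMl)); move: y; apply: mulset_ind.
- by rewrite homR0.
- by move=> x y; rewrite homRD; apply: PD.
move=> x y xr /rm; move: y; apply: mulset_ind => [|y z|_ z [u un <-] _].
- by rewrite mulr0 homR0.
- by rewrite mulrDr homRD; apply: PD.
have := inv_pow_swap z un; move: (inv_val u * z).
apply: mulset_ind => [|y t|s _ _ [t tn <-]].
- by rewrite mulr0 homR0.
- by rewrite mulrDr homRD; apply: PD.
rewrite mulrA [h _](homR_inv_act h t (x * s)); apply: hn => //.
exact: rMr.
Qed.

End Cofinal.

(** For the kernel, some r^n is killed by h, and b^n maps R into r^n. For the cokernel, h(r^n) lies
    in the image of f; if h(a) = f(m), then h(ae) is the image of [hom_avg m], and such ae generate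
    a right ideal containing b^(n+1). *)
Lemma hom_serre_equiv (Rnoeth : noetherian R)
    (cofinal_ar : cofinal (inv_radical X) (radical X))
    (M N : Mod invring) (f : mor M N) :
  serre_equiv (inv_radical X) f ->
  serre_equiv (skew_radical X) (fmap (hom_functor X) f).
Proof.
move=> /serre_equivP[tor_ker tor_coker]; apply/serre_equivP; split=> [h fh|h].
  have [|||n hn] := @hom_radical_pow Rnoeth cofinal_ar M (fun m => m = 0) h.
  - by [].
  - by move=> x y -> ->; rewrite addr0.
  - by move=> x; apply: tor_ker; apply: (congr1 (fun g : homR N => g x) fh).
  exists n => b bn; apply: homR_eq => x; apply: hn.
  exact: skew_pow_act.
have [|||n hn] := @hom_radical_pow Rnoeth cofinal_ar N
    (fun n => exists m, f m = n) h.
- by exists 0; rewrite linear0.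
- by move=> _ _ [x <-] [y <-]; exists (x + y); rewrite linearD.
- by move=> x; apply: tor_coker.
exists n.+1 => b /skew_pow_emb.
have [im0 imD imM] := right_ideal_preim_image (fmap (hom_functor X) f) h.
move: b; apply: mulset_ind => // _ b [a /hn[m fm] <-] _; apply: imM.
by exists (hom_avg m); rewrite ract_hom_emb -fm; apply: hom_avg_map.
Qed.

(** * Unit and counit *)

Section Unit.
Variable M : lmodType skew^c.

Fact unit_val_linear (m : M) : linear (fun x : Rr => tens m (x : Rl) : tensR M).
Proof.
move=> a x y; rewrite [tens m _]tensDr; congr (_ + _).
by apply: esym; apply: tensR_actE.
Qed.

Definition unit_val (m : M) : homR (tensR M) := HomR (unit_val_linear m).

Fact unit_val_is_linear : linear unit_val.
Proof.
move=> b m p; apply: homR_eq => x; rewrite /= tensDl; congr (_ + _).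
exact: tensZ.
Qed.

HB.instance Definition _ := GRing.isLinear.Build skew^c M (homR (tensR M)) *:%R
  unit_val unit_val_is_linear.

(** Exponent 1 works for both halves because b lies in (Re)B. If m (x) R = 0 then m(Re) = 0, and
    each h(ae) is a value of the unit. *)
Lemma unit_serre_equiv :
  @serre_equiv _ (skew_radical X) M (homR (tensR M))
    (unit_val : {linear _ -> _}).
Proof.
apply/serre_equivP; split=> [m um0|h]; exists 1 => b /skew_pow_emb.
  move: b; apply: mulset_ind => [|x y mx my|_ b [a _ <-] _].
  - exact: scale0r.
  - by rewrite /ract [LHS]scalerDl [X in X + _]mx [X in _ + X]my addr0.
  have /(congr1 (@tens_val M)) /= : unit_val m a = 0 by rewrite um0.
  by rewrite tens_valE tens_val0 /ract -scalerA => ->; rewrite scaler0.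
have [im0 imD imM] := right_ideal_preim_image
  (unit_val : {linear M -> homR (tensR M)}) h.
move: b; apply: mulset_ind => // _ b [a _ <-] _; apply: imM.
(* With h(a) = m (x) 1, the witness is me: me (x) x = m (x) avg(x) = h(a) avg(x). *)
exists (ract (tens_val (h a)) (emb 1)); rewrite ract_hom_emb.
apply: homR_eq => x /=; rewrite -[in RHS](tens_valK (h a)) [RHS]tensR_actE.
by rewrite tensZ; congr (tens _ _); rewrite /inv_act mul1r.
Qed.

End Unit.

Section Counit.
Variable N : lmodType invring^c.

Definition counit_val (t : tensR (homR N)) : N :=
  tens_lift (fun (h : homR N) (x : Rl) => h x) t.

Fact counit_bal : balanced (fun (h : homR N) (x : Rl) => h x).
Proof. by split=> // h x y; apply: homRD. Qed.

Lemma counit_valE h x : counit_val (tens h x) = h x.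
Proof. exact/tens_liftE/counit_bal. Qed.

Lemma counit_valD : {morph counit_val : t u / t + u}.
Proof. by move=> t u; apply/tens_liftD/counit_bal. Qed.

Fact counit_val_linear : linear counit_val.
Proof.
move=> a t u; rewrite counit_valD; congr (_ + _).
apply: (tens_ext (f := fun t => counit_val (tensR_act a t))
  (g := fun t => ract (counit_val t) a)).
- by move=> v w; rewrite tensR_actDr counit_valD.
- by move=> v w; rewrite counit_valD /ract scalerDr.
- by move=> h x; rewrite tensR_actE !counit_valE homR_inv_act.
Qed.

HB.instance Definition _ := GRing.isLinear.Build invring^c (tensR (homR N)) N
  *:%R counit_val counit_val_linear.

(** Exponent 0 means that kernel and cokernel vanish: the counit is bijective, with inverse n |->
    [hom_avg n] (x) 1. *)
Lemma counit_serre_equiv :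
  @serre_equiv _ (inv_radical X) (tensR (homR N)) N
    (counit_val : {linear _ -> _}).
Proof.
apply/serre_equivP; split=> [t t0|n]; exists 0 => x _.
  suff -> : t = 0 by rewrite /ract scaler0.
  have tvE := tens_valK t; have := t0; rewrite /= -tvE counit_valE => tv1.
  (* From 1 = e.1 one gets h (x) 1 = he (x) 1, and he = [hom_avg] of h(1) = 0. *)
  rewrite -(act_emb1 1) tens_act1 ract_hom_emb tv1.
  rewrite (_ : hom_avg 0 = 0); last by apply: homR_eq => y; apply: scaler0.
  exact: tens0l.
exists (tens (hom_avg (ract n x)) (1 : Rl)).
by rewrite /= counit_valE /= avg1 //; apply: scale1r.
Qed.

End Counit.

End SkewGroupAlgebra.

Theorem theorem0p3 (k : fieldType) (gT : finGroupType) (R : algType k)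
    (X : galgebra gT R)
    (Gnontriv : (1 < #|gT|)%N)
    (charkG : [pchar k]^'.-nat #|gT|)
    (Rnoeth : noetherian R)
    (cofinal_ar : cofinal (inv_radical X) (radical X))
    (AR_a : right_AR (inv_radical X)) :
  (exists H : functor (QMod (inv_radical X)) (QMod (skew_radical X)),
     induces (hom_functor X) H) /\
  ((exists T : functor (QMod (skew_radical X)) (QMod (inv_radical X)),
      induces (tensor_functor X) T) /\
   (forall (T : functor (QMod (skew_radical X)) (QMod (inv_radical X)))
           (H : functor (QMod (inv_radical X)) (QMod (skew_radical X))),
      induces (tensor_functor X) T -> induces (hom_functor X) H ->
      quasi_inverse T H)).
Proof.
split; last split.
- have FW (M N : Mod (invring X)) (f : mor M N) :
      serre_equiv (inv_radical X) f ->
      is_iso (fmap (fcomp (qproj (skew_radical X)) (hom_functor X)) f).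
    by move=> f_serre; apply/frac_proj_iso/hom_serre_equiv.
  by exists (frac_lift FW); apply: frac_liftE.
- have FW (M N : Mod (Defs.skew X)) (f : mor M N) :
      serre_equiv (skew_radical X) f ->
      is_iso (fmap (fcomp (qproj (inv_radical X)) (tensor_functor X)) f).
    by move=> f_serre; apply/frac_proj_iso/tensor_serre_equiv.
  by exists (frac_lift FW); apply: frac_liftE.
move=> T H indT indH; split; apply: nat_isomorphic_fractions.
  (* On modules, H T after projection becomes the projection of Hom_A(R, - (x)_B R), and the
     identity becomes the projection of the identity functor. The unit goes from the latter to the
     former, whence the symmetry step. *)
  rewrite fcompA [fcomp T _]indT -fcompA [fcomp H _]indH fcompA.
  rewrite fcomp1f -[X in nat_isomorphic _ X]fcompf1.
  apply: nat_isomorphic_sym.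
  apply: (@nat_isomorphic_proj _ _ (@serre_equiv _ (skew_radical X)) (fid _)
    (fcomp (hom_functor X) (tensor_functor X))
    (fun M => @unit_val _ _ _ X M : {linear _ -> _})) => [M N f|M]; last first.
    exact: unit_serre_equiv.
  apply: linear_eq => m; apply: homR_eq => x.
  by rewrite /= tensR_mapE.
rewrite fcompA [fcomp H _]indH -fcompA [fcomp T _]indT fcompA.
rewrite fcomp1f -[X in nat_isomorphic _ X]fcompf1.
apply: (@nat_isomorphic_proj _ _ (@serre_equiv _ (inv_radical X))
  (fcomp (tensor_functor X) (hom_functor X))
  (fid _) (fun N => @counit_val _ _ _ X N : {linear _ -> _})) => [M N f|N];
  last exact: counit_serre_equiv.
apply: linear_eq.
apply: (tens_ext (f := fun t => counit_val (tensR_map (homR_map f) t))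
  (g := fun t => f (counit_val t))).
- by move=> t u; rewrite tensR_mapD counit_valD.
- by move=> t u; rewrite counit_valD linearD.
- by move=> h x; rewrite tensR_mapE !counit_valE.
Qed.
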